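(* Let $\mathbb{K}$ be a commutative ring, $V$ a free $\mathbb{K}$-module with a fixed basis $\mathcal{V}$, $\upsilon\in\mathcal{RT}(n)$, and $\mathtt{t}_1,\ldots,\mathtt{t}_n\in\mathcal{S}(\mathcal{RT},\mathcal{V})$. Assume that the composite of $\upsilon$ and $\mathtt{t}_1,\ldots,\mathtt{t}_n$ in $S(PreLie,\mathbb{Z}[\mathcal{V}])$ (computed over $\mathbb{Z}$, where $\mathbb{Z}[\mathcal{V}]$ is the free $\mathbb{Z}$-module on $\mathcal{V}$) has the expansion $$\mu(\upsilon(\mathtt{t}_1,\ldots,\mathtt{t}_n))=\sum_{\mathtt{t}\in\mathcal{S}(\mathcal{RT},\mathcal{V})}\chi(\mathtt{t})\,\mathtt{t}.$$ Then in $\Gamma(PreLie,V)$ $$\tilde\mu(\mathcal{O}\upsilon(\mathcal{O}\mathtt{t}_1,\ldots,\mathcal{O}\mathtt{t}_n))=\sum_{\mathtt{t}}\frac{\chi(\mathtt{t})\,|\mathrm{Stab}(\mathtt{t})|}{|\mathrm{Stab}(\upsilon(\mathtt{t}_1,\ldots,\mathtt{t}_n))|\prod_i|\mathrm{Stab}(\mathtt{t}_i)|}\,\mathcal{O}\mathtt{t},$$ where $\tilde\mu:\Gamma(PreLie,\Gamma(PreLie,V))\to\Gamma(PreLie,V)$ is the multiplication of the monad and $\mathrm{Stab}(\upsilon(\mathtt{t}_1,\ldots,\mathtt{t}_n))$ is the stabilizer of $\upsilon(\mathtt{t}_1,\ldots,\mathtt{t}_n)\in\mathcal{S}(\mathcal{RT},\mathcal{W})$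 with $\mathcal{W}=\mathcal{S}(\mathcal{RT},\mathcal{V})$.
   Context: Operad $PreLie$. An $n$-tree is a finite non-empty connected acyclic graph with a distinguished vertex (the root) and a bijection between its vertices and $\{1,\ldots,n\}$ (trees are not planar); edges are oriented towards the root, and $In(\tau,i)$ is the set of edges of $\tau$ entering vertex $i$. $\mathcal{RT}(n)$ is the set of $n$-trees, with $\mathbb{S}_n$ acting by relabelling, and $PreLie(n)=\mathbb{K}[\mathcal{RT}(n)]$ is the free module on it (also denoted $RT(n)$; it can be formed over any ring). For $\tau\in\mathcal{RT}(m)$, $\upsilon\in\mathcal{RT}(n)$, $\tau\circ_i\upsilon=\sum_{f:In(\tau,i)\to\{1,\ldots,n\}}\tau\circ_i^f\upsilon$, where $\tau\circ_i^f\upsilon$ is obtained by substituting $\upsilon$ for vertex $i$ of $\tau$, attaching the outgoing edge of $i$ (if any) to the root of $\upsilon$, each incoming edge $e$ to vertex $f(e)$ of $\upsilon$, and relabelling with the usual shift. The unit is the $1$-tree. Functors. $S(PreLie,V)=\bigoplus_n(PreLie(n)\otimes V^{\otimes n})_{\mathbb{S}_n}$ (coinvariants) and $\Gamma(PreLie,V)=\bigoplus_n(PreLie(n)\otimes V^{\otimes n})^{\mathbb{S}_n}$ (invariants), for the diagonal action: $\sigma$ relabels vertex $i$ as $\sigma(i)$ and moves the $i$-th letter to position $\sigma(i)$. $S(PreLie,-)$ is a monad with multiplication $\mu$ induced by operadic composition. With $P=PreLie$ and $(M\boxtimes N)(n)=\bigoplus_{i+j=n}\mathrm{Ind}_{\mathbb{S}_i\times\mathbb{S}_j}^{\mathbb{S}_n}M(i)\otimes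 N(j)$, the trace (sum over the group) is an isomorphism $\bigoplus_r(P(r)\otimes P^{\boxtimes r})_{\mathbb{S}_r}\cong\bigoplus_r(P(r)\otimes P^{\boxtimes r})^{\mathbb{S}_r}$; its inverse followed by operadic composition induces the multiplication $\tilde\mu:\Gamma(P,\Gamma(P,V))\cong\Gamma(\bigoplus_r(P(r)\otimes P^{\boxtimes r})^{\mathbb{S}_r},V)\to\Gamma(P,V)$. Bases and orbits. For $\tau\in\mathcal{RT}(n)$ and $x_i\in\mathcal{V}$, $\tau\langle x_1,\ldots,x_n\rangle$ denotes $\tau\otimes x_1\otimes\cdots\otimes x_n$ and $\tau(x_1,\ldots,x_n)$ its class in $S(PreLie,V)$; the latter form the basis $\mathcal{S}(\mathcal{RT},\mathcal{V})$ of $S(PreLie,V)$ (it is the set of isomorphism classes of rooted trees with vertices decorated by $\mathcal{V}$). $\mathrm{Stab}(\tau(x_1,\ldots,x_n))=\{\sigma\in\mathbb{S}_n:\sigma^*\tau\langle x_1,\ldots,x_n\rangle=\tau\langle x_1,\ldots,x_n\rangle\}$, well defined up to isomorphism, and $\mathcal{O}\tau(x_1,\ldots,x_n)=\sum_{\sigma\in\mathbb{S}_n/\mathrm{Stab}}\sigma^*\tau\langle x_1,\ldots,x_n\rangle\in\Gamma(PreLie,V)$. The elements $\mathcal{O}\mathtt{t}$, $\mathtt{t}\in\mathcal{S}(\mathcal{RT},\mathcal{V})$, form a basis of $\Gamma(PreLie,V)$, and $\mathcal{O}\upsilon(\mathcal{O}\mathtt{t}_1,\ldots,\mathcal{O}\mathtt{t}_n)\in\Gamma(PreLie,\Gamma(PreLie,V))$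 is the orbit sum formed with respect to that basis. The coefficients in the formula are integers, mapped to $\mathbb{K}$. *)

(* Defs.v *)
From HB Require Import structures.
From mathcomp Require Import all_boot all_order all_algebra all_fingroup.
From mathcomp Require Import finmap monalg boolp classical_sets.

Set Implicit Arguments.
Unset Strict Implicit.
Unset Printing Implicit Defensive.

Import GRing.Theory.

Local Open Scope quotient_scope.
Local Open Scope ring_scope.

(* The free K-module on a set A is {malg K[A]}.  Linear maps between free
   modules are given by their values on basis elements.  Scalars act through
   mkmalgU because K may be the zero ring, for which {malg K[A]} has no
   lmodType instance. *)

Section Linear.
Variable K : comPzRingType.

Definition mscale (A : choiceType) (c : K) (f : {malg K[A]}) : {malg K[A]} :=
  \sum_(a <- msupp f) << c * f@_a *g a >>.

Definition linext (A B : choiceType) (F : A -> {malg K[B]})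
    (f : {malg K[A]}) : {malg K[B]} :=
  \sum_(a <- msupp f) mscale f@_a (F a).

Lemma mcoeff_mscale (A : choiceType) c (f : {malg K[A]}) k :
  (mscale c f)@_k = c * f@_k.
Proof.
rewrite {2}[f]monalgE /mscale !raddf_sum mulr_sumr /=.
by apply: eq_bigr => a _; rewrite !mcoeffU mulrnAr.
Qed.

Lemma linextEw (A B : choiceType) (F : A -> {malg K[B]}) f (D : {fset A}) :
  {subset msupp f <= D} -> linext F f = \sum_(a <- D) mscale f@_a (F a).
Proof.
move=> fD; apply/malgP=> k; rewrite /linext !raddf_sum /=.
apply: big_fset_incl; first exact/fsubsetP.
move=> a _ /mcoeff_outdom fa.
by rewrite mcoeff_mscale fa mul0r.
Qed.

Lemma linextD (A B : choiceType) (F : A -> {malg K[B]}) f g :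
  linext F (f + g) = linext F f + linext F g.
Proof.
have sD : {subset msupp (f + g) <= (msupp f `|` msupp g)%fset}.
  exact/fsubsetP/msuppD_le.
have sl : {subset msupp f <= (msupp f `|` msupp g)%fset}.
  exact/fsubsetP/fsubsetUl.
have sr : {subset msupp g <= (msupp f `|` msupp g)%fset}.
  exact/fsubsetP/fsubsetUr.
rewrite (linextEw F sD) (linextEw F sl) (linextEw F sr) -big_split /=.
apply: eq_bigr => a _; apply/malgP=> k.
by rewrite mcoeff_mscale !mcoeffD mulrDl !mcoeff_mscale.
Qed.

Lemma linext0 (A B : choiceType) (F : A -> {malg K[B]}) : linext F 0 = 0.
Proof. by rewrite /linext msupp0 big_seq_fset0. Qed.

Lemma linext_sum (A B : choiceType) (F : A -> {malg K[B]}) I (r : seq I)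
    (P : pred I) (f : I -> {malg K[A]}) :
  linext F (\sum_(i <- r | P i) f i) = \sum_(i <- r | P i) linext F (f i).
Proof. exact: (big_morph _ (@linextD A B F) (linext0 F)). Qed.

Lemma linextU (A B : choiceType) (F : A -> {malg K[B]}) a :
  linext F << a >> = F a.
Proof.
rewrite (@linextEw _ _ _ _ [fset a]%fset); last exact/fsubsetP/msuppU_le.
rewrite big_seq_fset1 mcoeffU eqxx; apply/malgP=> k.
by rewrite mcoeff_mscale mul1r.
Qed.

(* f_1 (x) ... (x) f_r, where K[A]^{(x) r} is identified with K[A^r]. *)
Definition tensor (A : choiceType) r (f : 'I_r -> {malg K[A]}) :
    {malg K[{ffun 'I_r -> A}]} :=
  let D := \big[fsetU/fset0]_(j < r) msupp (f j) in
  \sum_(a : {ffun 'I_r -> D})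
    << \prod_(j < r) (f j)@_(val (a j)) *g [ffun j => val (a j)] >>.

End Linear.

(* A rooted tree with vertex set 'I_n: its root, and the map sending a vertex
   to the target of its outgoing edge; by convention the root, which has no
   outgoing edge, is sent to itself. *)
Definition is_rt n (t : 'I_n * {ffun 'I_n -> 'I_n}) : bool :=
  (t.2 t.1 == t.1) && [forall i, fconnect t.2 i t.1].

Record RT (n : nat) : predArgType :=
  MkRT { rt_val : 'I_n * {ffun 'I_n -> 'I_n}; rt_valP : is_rt rt_val }.
HB.instance Definition _ n := [isSub for @rt_val n].
HB.instance Definition _ n := [Finite of RT n by <:].

Definition root n (t : RT n) : 'I_n := (rt_val t).1.
Definition parent n (t : RT n) : {ffun 'I_n -> 'I_n} := (rt_val t).2.

Lemma parent_root n (t : RT n) : parent t (root t) = root t.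
Proof. by case/andP: (rt_valP t) => /eqP. Qed.

Lemma connect_root n (t : RT n) i : fconnect (parent t) i (root t).
Proof. by case/andP: (rt_valP t) => _ /forallP. Qed.

Lemma relabel_subproof n (s : 'S_n) (t : RT n) :
  is_rt (s (root t), [ffun k => s (parent t ((s^-1)%g k))]).
Proof.
apply/andP; split=> /=; first by rewrite ffunE permK parent_root.
apply/forallP=> i; rewrite -[i](permKV s).
have /iter_findex <- := connect_root t ((s^-1)%g i).
elim: (findex _ _ _) => [|m /connect_trans]; first exact: connect0.
apply; apply/connect1/eqP => /=.
by rewrite ffunE permK.
Qed.

Definition relabel n (s : 'S_n) (t : RT n) : RT n := MkRT (relabel_subproof s t).

(* Incoming edges of i, an edge being represented by its source. *)
Definition incoming m (t : RT m) (i : 'I_m) : predArgType :=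
  {j : 'I_m | (j != root t) && (parent t j == i)}.
HB.instance Definition _ m (t : RT m) i := Finite.on (incoming t i).

(* Substitution of u for the vertex i of t.  The vertices of the result are,
   in increasing order, the vertices of t before i, those of u, and the
   vertices of t after i. *)
Section Substitution.
Variables (m n : nat) (t : RT m) (i : 'I_m) (u : RT n).

Lemma split_at_subproof : m = (i + 1 + (m - i.+1))%N.
Proof. by rewrite addn1 subnKC. Qed.

Definition inner (k : 'I_n) : 'I_(i + n + (m - i.+1)) :=
  lshift _ (rshift i k).

(* The new name of the vertex j of t; the vertex i is replaced by d. *)
Definition outer (d : 'I_(i + n + (m - i.+1))) (j : 'I_m) :
    'I_(i + n + (m - i.+1)) :=
  match split (cast_ord split_at_subproof j) with
  | inl p => if split p is inl a then lshift _ (lshift n a) else d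
  | inr c => rshift (i + n) c
  end.

Definition newroot : 'I_(i + n + (m - i.+1)) := outer (inner (root u)) (root t).

Variable f : {ffun incoming t i -> 'I_n}.

Definition parent_outer (j : 'I_m) : 'I_(i + n + (m - i.+1)) :=
  if insub j is Some e then inner (f e)
  else outer (inner (root u)) (parent t j).

Definition parent_inner (k : 'I_n) : 'I_(i + n + (m - i.+1)) :=
  if k == root u then outer (inner (root u)) (parent t i)
  else inner (parent u k).

Definition newparent : {ffun 'I_(i + n + (m - i.+1)) -> 'I_(i + n + (m - i.+1))} :=
  [ffun x => match split x with
    | inl p =>
        match split p with
        | inl a =>
            parent_outer (cast_ord (esym split_at_subproof)
                            (lshift _ (lshift 1 a)))
        | inr k => parent_inner k
        end
    | inr c =>
        parent_outer (cast_ord (esym split_at_subproof) (rshift (i + 1) c))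
    end].

Lemma newparent_inner k : newparent (inner k) = parent_inner k.
Proof. by rewrite ffunE /inner (unsplitK (inl _)) (unsplitK (inr _)). Qed.

Lemma outer_at d : outer d i = d.
Proof.
rewrite /outer; have -> : cast_ord split_at_subproof i = lshift _ (rshift i ord0).
  by apply: val_inj; rewrite /= addn0.
by rewrite (unsplitK (inl _)) (unsplitK (inr _)).
Qed.

Lemma newparent_outer d j : j != i -> newparent (outer d j) = parent_outer j.
Proof.
move=> ji; rewrite /outer.
have [j' ej] : exists j', j = cast_ord (esym split_at_subproof) j'.
  by exists (cast_ord split_at_subproof j); rewrite cast_ordK.
rewrite ej cast_ordKV.
case: (splitP j') => [p e|c e].
  have {e} e : j' = lshift _ p by apply: val_inj.
  case: (splitP p) => [a e'|z e'].
    have {e'} e' : p = lshift _ a by apply: val_inj.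
    by rewrite ffunE (unsplitK (inl _)) (unsplitK (inl _)) e e'.
  case/eqP: ji; apply: val_inj; rewrite ej /= e /= e'.
  by rewrite (ord1 z) addn0.
have {e} e : j' = rshift _ c by apply: val_inj.
by rewrite ffunE (unsplitK (inr _)) e.
Qed.

Lemma outer_inner_cases (P : 'I_(i + n + (m - i.+1)) -> Prop) :
  (forall k, P (inner k)) -> (forall d j, j != i -> P (outer d j)) ->
  forall x, P x.
Proof.
move=> Pin Pout x.
suff [[k ->]|[j ji ->]] : (exists k, x = inner k) \/
    exists2 j, j != i & x = outer x j.
- exact: Pin.
- exact: Pout.
rewrite /outer; case: (splitP x) => [p e|c e].
  have {e} e : x = lshift _ p by apply: val_inj.
  case: (splitP p) => [a e'|k e'].
    right; exists (cast_ord (esym split_at_subproof) (lshift _ (lshift 1 a))).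
      by rewrite -val_eqE /= neq_ltn ltn_ord.
    rewrite cast_ordKV (unsplitK (inl _)) (unsplitK (inl _)) e.
    by congr lshift; apply: val_inj.
  by left; exists k; rewrite e; congr lshift; apply: val_inj.
right; exists (cast_ord (esym split_at_subproof) (rshift (i + 1) c)).
  by rewrite -val_eqE /= neq_ltn addn1 ltnS leq_addr orbT.
rewrite cast_ordKV (unsplitK (inr _)); exact: val_inj.
Qed.

Lemma outer_irr d d' j : j != i -> outer d j = outer d' j.
Proof.
move=> ji; rewrite /outer.
have [j' ej] : exists j', j = cast_ord (esym split_at_subproof) j'.
  by exists (cast_ord split_at_subproof j); rewrite cast_ordK.
rewrite ej cast_ordKV.
case: (splitP j') => // p e; case: (splitP p) => // z e'.
case/eqP: ji; apply: val_inj; rewrite ej /= e /= e'.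
by rewrite (ord1 z) addn0.
Qed.

Lemma subst_subproof : is_rt (newroot, newparent).
Proof.
have inC k : fconnect newparent (inner k) (inner (root u)).
  have /iter_findex <- := connect_root u k.
  elim: (findex _ _ _) => [|q /connect_trans]; first exact: connect0.
  apply; rewrite iterS; set k' := iter _ _ _.
  have [e|ne] := eqVneq k' (root u).
    by rewrite {2}e parent_root -e connect0.
  apply/connect1/eqP; rewrite [LHS]newparent_inner /parent_inner.
  by rewrite (negPf ne).
have outC j : fconnect newparent (outer (inner (root u)) j) newroot.
  rewrite /newroot; have /iter_findex <- := connect_root t j.
  elim: (findex _ _ _) => [|q /connect_trans]; first exact: connect0.
  apply; rewrite iterS; set j' := iter _ _ _.
  have [->|ne] := eqVneq j' i.
    rewrite outer_at; apply/connect1/eqP; rewrite [LHS]newparent_inner.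
    by rewrite /parent_inner eqxx.
  have e := newparent_outer (inner (root u)) ne.
  apply: (@connect_trans _ _ (parent_outer j')); first exact/connect1/eqP.
  rewrite /parent_outer.
  case: insubP => [z /andP[_ /eqP ->] _|_]; last exact: connect0.
  by rewrite outer_at; apply: inC.
apply/andP; split=> /=.
  rewrite /newroot; have [e|ne] := eqVneq (root t) i.
    have pe : parent t i = i by rewrite -{1}e parent_root.
    by rewrite e outer_at newparent_inner /parent_inner eqxx pe outer_at.
  rewrite newparent_outer // /parent_outer insubF ?parent_root //.
  by rewrite eqxx.
apply/forallP; apply: outer_inner_cases => [k|d j ji].
  by apply: (connect_trans (inC k)); rewrite -[inner _]outer_at; apply: outC.
by rewrite (outer_irr d (inner (root u)) ji); apply: outC.
Qed.

Definition subst : RT (i + n + (m - i.+1)) := MkRT subst_subproof.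

End Substitution.

(* The basis of the sum over n of the modules PreLie(n). *)
Definition tree : choiceType := {n : nat & RT n}.

Section PreLie.
Variable K : comPzRingType.

(* The partial composition of the operad PreLie; positions start at 0. *)
Definition partial_comp (i : nat) (u t : tree) : {malg K[tree]} :=
  if insub i is Some i' then
    \sum_(f : {ffun incoming (tagged t) i' -> 'I_(tag u)})
      << Tagged RT (subst (i := i') (tagged u) f) >>
  else 0.

(* ((x o_(i+k) ts_k) ... o_(i+1) ts_1) o_i ts_0, starting from the rightmost
   position so that the positions still to be filled are not shifted. *)
Fixpoint comp_from (i : nat) (ts : seq tree) (x : {malg K[tree]}) :
    {malg K[tree]} :=
  if ts is t :: ts' then linext (partial_comp i t) (comp_from i.+1 ts' x)
  else x.

Definition operad_comp (r : nat) (u : RT r) (ts : 'I_r -> tree) :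
    {malg K[tree]} :=
  comp_from 0 [seq ts j | j <- enum 'I_r] << Tagged RT u >>.

End PreLie.

(* The basis of the sum over n of the modules PreLie(n) (x) V^{(x) n}, where V
   is free on X: trees with vertices labelled by 'I_n together with n letters. *)
Definition word (X : choiceType) (n : nat) : choiceType :=
  (RT n * {ffun 'I_n -> X})%type.
Definition lab (X : choiceType) : choiceType := {n : nat & word X n}.

Definition ltree (X : choiceType) (a : lab X) : RT (tag a) := (tagged a).1.
Definition letter (X : choiceType) (a : lab X) : {ffun 'I_(tag a) -> X} :=
  (tagged a).2.
Definition mklab (X : choiceType) n (t : RT n) (x : {ffun 'I_n -> X}) : lab X :=
  Tagged (word X) (t, x).

Section Action.
Variable X : choiceType.

Definition word_act n (s : 'S_n) (w : word X n) : word X n :=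
  (relabel s w.1, [ffun k => w.2 ((s^-1)%g k)]).

Definition act (a : lab X) (s : 'S_(tag a)) : lab X :=
  Tagged (word X) (word_act s (tagged a)).

Definition stab (a : lab X) : {set 'S_(tag a)} := [set s | act s == a].

Definition same_orbit : rel (lab X) :=
  fun a b => [exists s : 'S_(tag a), act s == b].

Lemma relabel1 n (t : RT n) : relabel 1 t = t.
Proof.
apply: val_inj; case: t => [[r p] tP] /=; rewrite perm1; congr pair.
by apply/ffunP=> k; rewrite ffunE invg1 !perm1.
Qed.

Lemma relabelM n (s s' : 'S_n) (t : RT n) :
  relabel (s * s') t = relabel s' (relabel s t).
Proof.
apply: val_inj; rewrite /= /root /parent /= permM; congr pair.
by apply/ffunP=> k; rewrite !ffunE invMg !permM.
Qed.

Lemma word_act1 n (w : word X n) : word_act 1 w = w.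
Proof.
case: w => t x; rewrite /word_act relabel1; congr pair.
by apply/ffunP=> k; rewrite ffunE invg1 perm1.
Qed.

Lemma word_actM n (s s' : 'S_n) (w : word X n) :
  word_act (s * s') w = word_act s' (word_act s w).
Proof.
rewrite /word_act relabelM; congr pair.
by apply/ffunP=> k; rewrite !ffunE invMg permM.
Qed.

Lemma act1 a : act (a := a) 1 = a.
Proof. by case: a => n w; rewrite /act word_act1. Qed.

Lemma actM (a : lab X) (s s' : 'S_(tag a)) :
  act (a := a) (s * s') = act (a := act s) s'.
Proof. by rewrite /act word_actM. Qed.

Lemma mem_stab (a : lab X) (s : 'S_(tag a)) :
  (s \in stab a) = (word_act s (tagged a) == tagged a).
Proof. by case: a s => n w s; rewrite inE /act eq_Tagged. Qed.

Lemma act_stab (a : lab X) (s s' : 'S_(tag a)) :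
  s \in stab a -> act (a := a) (s * s') = act (a := a) s'.
Proof. by rewrite mem_stab /act word_actM => /eqP ->. Qed.

Lemma same_orbit_is_equiv : equiv_class_of same_orbit.
Proof.
have sym a b : same_orbit a b -> same_orbit b a.
  case/existsP=> s /eqP <-; apply/existsP; exists (s^-1)%g.
  by rewrite -actM mulgV act1.
split=> [a|a b|b a c]; first by apply/existsP; exists 1%g; rewrite act1.
  by apply/idP/idP; apply: sym.
case/existsP=> s /eqP <- /existsP[s' /eqP <-].
by apply/existsP; exists (s * s')%g; rewrite actM.
Qed.

Canonical same_orbit_equiv := EquivRelPack same_orbit_is_equiv.
Canonical same_orbit_encModRel := defaultEncModRel same_orbit.

End Action.

(* The set S(RT, X). *)
Definition SRT (X : choiceType) : choiceType := {eq_quot (@same_orbit X)}.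

Definition cls (X : choiceType) (a : lab X) : SRT X :=
  \pi_({eq_quot (@same_orbit X)}) a.
Definition rep (X : choiceType) (t : SRT X) : lab X := generic_quotient.repr t.

(* The cardinality of Stab(t). *)
Definition nstab (X : choiceType) (t : SRT X) : nat := #|stab (rep t)|.

Section Functors.
Variables (K : comPzRingType) (X : choiceType).

(* The action on the sum over n of PreLie(n) (x) V^{(x) n} of a family of
   permutations, one for each degree. *)
Definition permute (s : forall n, 'S_n) : {malg K[lab X]} -> {malg K[lab X]} :=
  linext (fun a => << act (a := a) (s (tag a)) >>).

(* The submodule spanned by the elements s f - f. *)
Inductive coinv_span : {malg K[lab X]} -> Prop :=
| coinv_span0 : coinv_span 0
| coinv_spanB f g : coinv_span f -> coinv_span g -> coinv_span (f - g)
| coinv_span_gen s f : coinv_span (permute s f - f).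

Definition coinv_pred : {pred {malg K[lab X]}} :=
  fun f => `[< coinv_span f >].

Lemma coinv_pred_closed : zmod_closed coinv_pred.
Proof.
split=> [|f g /asboolP cf /asboolP cg]; apply/asboolP.
  exact: coinv_span0.
exact: coinv_spanB.
Qed.
HB.instance Definition _ :=
  GRing.isZmodClosed.Build {malg K[lab X]} coinv_pred coinv_pred_closed.

(* S(PreLie, V) *)
Definition SPreLie : zmodType := Quotient.quot coinv_pred.

Definition to_S (f : {malg K[lab X]}) : SPreLie := \pi_SPreLie f.

(* The element of S(PreLie, V) given by t in S(RT, X). *)
Definition Sbasis (t : SRT X) : SPreLie := to_S << rep t >>.

Definition invariant (f : {malg K[lab X]}) : Prop :=
  forall s : forall n, 'S_n, permute s f = f.

(* Gamma(PreLie, V) *)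
Record GammaPreLie : Type :=
  MkGamma { gamma_val : {malg K[lab X]}; gamma_valP : invariant gamma_val }.

Definition orbit_sum (a : lab X) : {malg K[lab X]} :=
  \sum_(C in rcosets (stab a) [set: 'S_(tag a)]%SET)
    << act (a := a) (fingroup.repr C) >>.

Lemma invariant_orbit_sum a : invariant (orbit_sum a).
Proof.
move=> s; rewrite /permute /orbit_sum linext_sum; set z := s (tag a).
have stab1 : (1%g : 'S_(tag a)) \in stab a by rewrite inE act1.
have mem_rep C : C \in rcosets (stab a) [set: 'S_(tag a)]%SET ->
    fingroup.repr C \in C.
  case/rcosetsP=> x _ ->.
  have xC : x \in (stab a :* x)%g by apply/rcosetP; exists 1%g; rewrite ?mul1g.
  exact: mem_repr xC.
have act_repr C y : C \in rcosets (stab a) [set: 'S_(tag a)]%SET -> y \in C ->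
    act (a := a) (fingroup.repr C) = act (a := a) y.
  move=> CP; move: (mem_rep C CP); case/rcosetsP: CP => x _ ->.
  by case/rcosetP=> h' hs' -> /rcosetP[h hs ->]; rewrite !act_stab.
have closed y C : C \in rcosets (stab a) [set: 'S_(tag a)]%SET ->
    (C :* y)%g \in rcosets (stab a) [set: 'S_(tag a)]%SET.
  case/rcosetsP=> x _ ->; rewrite -rcosetM.
  by apply/rcosetsP; exists (x * y)%g; rewrite ?inE.
rewrite [RHS](reindex (fun C : {set 'S_(tag a)} => (C :* z)%g)) /=; last first.
  exists (fun C => (C :* z^-1)%g) => C _.
    by rewrite -rcosetM mulgV rcoset1.
  by rewrite -rcosetM mulVg rcoset1.
apply: eq_big => [C|C CP].
  apply/idP/idP; first exact: closed.
  by move/(closed (z^-1)%g); rewrite -rcosetM mulgV rcoset1.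
have Cz : (fingroup.repr C * z)%g \in (C :* z)%g.
  by apply/rcosetP; exists (fingroup.repr C); rewrite ?mem_rep.
by rewrite linextU (act_repr _ _ (closed z C CP) Cz) actM.
Qed.

(* The basis element O t of Gamma(PreLie, V). *)
Definition orb (t : SRT X) : GammaPreLie :=
  MkGamma (invariant_orbit_sum (rep t)).

End Functors.

Section Composition.
Variables (K : comPzRingType) (X : choiceType).

(* The number of vertices of the composite of b = u<a_1, ..., a_r>. *)
Definition width (b : lab (lab X)) : nat := (\sum_j tag (letter b j))%N.

(* The composite in the sum of the PreLie(n) (x) V^{(x) n} of an element of
   PreLie(r) (x) (PreLie(n_1) (x) V^{(x) n_1}) (x) ... : the trees are composed
   and the words are concatenated. *)
Definition comp_lab (b : lab (lab X)) : {malg K[lab X]} :=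
  let g := operad_comp K (ltree b) (fun j => Tagged RT (ltree (letter b j))) in
  \sum_(t : RT (width b))
    << g@_(Tagged RT t) *g
       mklab t [ffun k : 'I_(width b) =>
                 letter (letter b (tagnat.sig1 k)) (tagnat.sig2 k)] >>.

End Composition.

(* The multiplication S(PreLie, S(PreLie, V)) -> S(PreLie, V), where
   S(PreLie, V) is identified with the free module on S(RT, X).  The class does
   not depend on the representatives chosen by rep and repr. *)
Definition mu (K : comPzRingType) (X : choiceType)
    (q : SPreLie K (SRT X)) : SPreLie K X :=
  to_S (linext
          (fun b => comp_lab K (mklab (ltree b) [ffun j => rep (letter b j)]))
          (generic_quotient.repr q)).

Section GammaMultiplication.
Variables (K : comPzRingType) (X : choiceType).

(* The inclusion of PreLie(r) (x) Gamma(PreLie, V)^{(x) r} in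
   PreLie(r) (x) (sum over n of PreLie(n) (x) V^{(x) n})^{(x) r}, where
   Gamma(PreLie, V) is identified with the free module on S(RT, X) by orb. *)
Definition expand_orbits (b : lab (SRT X)) : {malg K[lab (lab X)]} :=
  linext (fun a => << mklab (ltree b) a >>)
         (tensor (fun j => gamma_val (orb K (letter b j)))).

(* The coset representatives of S_n modulo S_(n_1) x ... x S_(n_r): the
   permutations that are increasing on each block. *)
Definition shuffle (b : lab (lab X)) (g : 'S_(width b)) : bool :=
  [forall k : 'I_(width b), forall l : 'I_(width b),
    (tagnat.sig1 k == tagnat.sig1 l) && (k < l)%N ==> (g k < g l)%N].

(* A basis element g (x) u (x) (t_1 (x) ... (x) t_r) of
   PreLie(r) (x) Ind (PreLie(n_1) (x) ... (x) PreLie(n_r)), with g a shuffle,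
   together with n letters, is encoded by writing next to each letter its
   position, given by g, in {0, ..., n-1}.  In this encoding the action of S_r
   is the action on the outer tree. *)
Definition place (b : lab (lab X)) (g : 'S_(width b)) : lab (lab (nat * X)%type) :=
  mklab (ltree b)
    [ffun j => mklab (ltree (letter b j))
      [ffun k => (val (g (tagnat.Rank j k)), letter (letter b j) k)]].

Definition placed (c : lab (lab (nat * X)%type)) : Prop :=
  exists b, exists2 g : 'S_(width b), shuffle g & c = place g.

(* The isomorphism from invariants under S_(n_1) x ... x S_(n_r) to invariants
   under S_n of the induced module. *)
Definition induce (b : lab (lab X)) : {malg K[lab (lab (nat * X)%type)]} :=
  \sum_(g : 'S_(width b) | shuffle g) << place g >>.

Definition trace (Y : choiceType) : {malg K[lab Y]} -> {malg K[lab Y]} :=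
  linext (fun c => \sum_(s : 'S_(tag c)) << act s >>).

(* A preimage under the trace in PreLie(r) (x) Ind (...).  Its class in the
   coinvariants under S_r is unique, and comp_placed factors through it. *)
Definition trace_inv (y : {malg K[lab (lab (nat * X)%type)]}) :
    {malg K[lab (lab (nat * X)%type)]} :=
  xget 0 [set z | (forall c, c \in msupp z -> placed c) /\ trace z = y]%classic.

(* The operadic composite of g (x) u (x) (t_1 (x) ... (x) t_r): the vertices
   of the composite of u and the t_j are relabelled by g. *)
Definition unplace (d : lab (nat * X)%type) : {malg K[lab X]} :=
  if [pick g : 'S_(tag d) | [forall k, val (g k) == (letter d k).1]] is Some g
  then << act (a := mklab (ltree d) [ffun k => (letter d k).2]) g >>
  else 0.

Definition comp_placed (c : lab (lab (nat * X)%type)) : {malg K[lab X]} :=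
  linext unplace (comp_lab K c).

(* The multiplication of the monad Gamma(PreLie, -), with values in the sum of
   the PreLie(n) (x) V^{(x) n}, which contains Gamma(PreLie, V). *)
Definition mu_tilde (x : GammaPreLie K (SRT X)) : {malg K[lab X]} :=
  linext comp_placed
    (trace_inv (linext induce (linext expand_orbits (gamma_val x)))).

End GammaMultiplication.

(* Main.v *)
Require Import Defs.
From mathcomp Require Import all_boot all_order all_algebra all_fingroup.
From mathcomp Require Import finmap monalg boolp.
From mathcomp Require classical_sets.
From mathcomp Require Import zify.
(* From here on, root and act are those of rooted trees and labelled trees. *)
Import Defs.

Set Implicit Arguments.
Unset Strict Implicit.
Unset Printing Implicit Defensive.

Import GRing.Theory.

Local Open Scope ring_scope.

(** Both multiplications are read off from one kind of number.  Let u be a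
    tree with r vertices, b_1, ..., b_r trees with letters on their vertices,
    and a one more such tree.  Let N(u, b; a) be the number of bijections phi
    from the disjoint union of the vertex sets of the b_j onto the vertices of
    a that present a as a composite of u with b_1, ..., b_r: phi preserves
    letters, carries the edges of every b_j to edges of a, carries the root of
    b_(root u) to the root of a, and the edge of a leaving the root of b_j, for
    j not the root of u, ends in the block of the parent of j in u
    ([composite], [num_composites]).

    The operadic composite of u with trees t_1, ..., t_r is the sum of all
    trees that are composites for the standard numbering of the blocks, each
    with coefficient one ([mcoeff_comp_from], [mcoeff_comp_lab]).  Hence the
    sum of all relabellings of the composite has coefficient N(u, b; a) at a
    ([mcoeff_trace_comp]), and this number does not change when the vertices
    of u are permuted together with the b_j ([num_composites_act]).

    Coinvariants.  The sum over all relabellings (the trace) is defined on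
    coinvariants.  It maps the class of a to |Stab a| times its orbit sum, so
    tracing the expansion of mu(u(t_1, ..., t_r)) gives
    N(u, t; a) = chi(a) |Stab a| ([mcoeff_mu]).

    Invariants.  Let y be the image of O u(O t_1, ..., O t_r) in the sum of the
    modules P(r) (x) Ind(P(n_1) (x) ... (x) P(n_r)), tensored with words.  The
    group S_r acts freely on the basis of this module, so over any ring y has a
    preimage z under the trace, unique in the coinvariants
    ([trace_preimage], [comp_placed_trace]).  Now |Stab(u(t_1, ..., t_r))| y is
    the trace of the element obtained from the single representative
    u<t_1, ..., t_r> by expanding the orbit sums and shuffling
    ([trace_expand_induce]).  The composite of that element, multiplied by
    the product of the |Stab t_i|, is a sum over all permutations inside the
    blocks and all shuffles.  A bijection is in exactly one way a permutation
    inside the blocks followed by a shuffle, so this sum has coefficient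
    N(u, t; a) at a ([mcoeff_expand_comp]).  Altogether
    |Stab(u(t_1, ..., t_r))| prod_i |Stab t_i| mu~(...)_a = N(u, t; a).

    Over the integers the two formulas for N(u, t; a) give the divisibility and
    the value of mu~.  All elements involved have integral coefficients and
    are compatible with the map from the integers to K, so the result over K
    is the image of the one over the integers ([mu_tilde_intr]). *)

(** * Linear extensions *)

Lemma mcoeff_sum (K : comPzRingType) (A : choiceType) I (l : seq I) (P : pred I)
    (f : I -> {malg K[A]}) a :
  (\sum_(i <- l | P i) f i)@_a = \sum_(i <- l | P i) (f i)@_a.
Proof. exact: raddf_sum. Qed.

Lemma mcoeff_sum_msupp (K : comPzRingType) (A : choiceType) (f : {malg K[A]}) a :
  f@_a = \sum_(c <- msupp f) f@_c * (c == a)%:R.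
Proof.
rewrite {1}[f]monalgE mcoeff_sum; apply: eq_bigr => c _.
by rewrite mcoeffU mulr_natr.
Qed.

Lemma mcoeff_linext (K : comPzRingType) (A B : choiceType) (F : A -> {malg K[B]}) f b :
  (linext F f)@_b = \sum_(a <- msupp f) f@_a * (F a)@_b.
Proof.
rewrite /linext raddf_sum; apply: eq_bigr => a _; exact: mcoeff_mscale.
Qed.

(** The form in which coefficients of compositions of linear maps are computed
    below: each target basis element is reached from one source basis element. *)
Lemma mcoeff_linext1 (K : comPzRingType) (A B : choiceType) (F : A -> {malg K[B]}) f b a :
  (forall a', a' \in msupp f -> a' != a -> (F a')@_b = 0) ->
  (linext F f)@_b = f@_a * (F a)@_b.
Proof.
move=> h; rewrite mcoeff_linext.
have [af|af] := boolP (a \in msupp f); last first.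
  rewrite (mcoeff_outdom af) mul0r big1_seq // => a' /= a'f.
  by rewrite h ?mulr0 //; apply: contraNneq af => <-.
rewrite (bigD1_seq a) ?fset_uniq //= big1_seq ?addr0 // => a' /andP[n a'f].
by rewrite h ?mulr0.
Qed.

Lemma mcoeff_linext0 (K : comPzRingType) (A B : choiceType) (F : A -> {malg K[B]}) f b :
  (forall a', a' \in msupp f -> (F a')@_b = 0) ->
  (linext F f)@_b = 0.
Proof. by move=> h; rewrite mcoeff_linext big1_seq // => a /= /h ->; rewrite mulr0. Qed.

Section LinextLemmas.
Variable K : comPzRingType.

Lemma mscale_linext (A B : choiceType) (F : A -> {malg K[B]}) c f :
  linext F (mscale c f) = mscale c (linext F f).
Proof.
have s : {subset msupp (mscale c f) <= msupp f}.
  move=> a; rewrite -!mcoeff_neq0 mcoeff_mscale.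
  by apply: contraNneq => ->; rewrite mulr0.
rewrite (linextEw _ s); apply/malgP=> b; rewrite mcoeff_mscale.
rewrite mcoeff_linext mcoeff_sum mulr_sumr; apply: eq_bigr => a _.
by rewrite !mcoeff_mscale mulrA.
Qed.

Lemma linext_comp (A B C : choiceType) (F : A -> {malg K[B]}) (G : B -> {malg K[C]}) f :
  linext G (linext F f) = linext (fun a => linext G (F a)) f.
Proof.
by rewrite [linext F f]/linext linext_sum; apply: eq_bigr => a _; rewrite mscale_linext.
Qed.

Lemma eq_linext (A B : choiceType) (F G : A -> {malg K[B]}) f :
  (forall a, a \in msupp f -> F a = G a) -> linext F f = linext G f.
Proof.
by move=> h; rewrite /linext [LHS]big_seq [RHS]big_seq; apply: eq_bigr => a /h ->.
Qed.

Lemma linextN (A B : choiceType) (F : A -> {malg K[B]}) f : linext F (- f) = - linext F f.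
Proof. by apply/eqP; rewrite -addr_eq0 -linextD addNr linext0. Qed.

Lemma linextB (A B : choiceType) (F : A -> {malg K[B]}) f g :
  linext F (f - g) = linext F f - linext F g.
Proof. by rewrite linextD linextN. Qed.

Lemma linextMn (A B : choiceType) (F : A -> {malg K[B]}) f n :
  linext F (f *+ n) = linext F f *+ n.
Proof. by elim: n => [|n IHn]; rewrite ?mulr0n ?linext0 // !mulrS linextD IHn. Qed.

Lemma mcoeff_tensor (A : choiceType) r (f : 'I_r -> {malg K[A]}) a :
  (tensor f)@_a = \prod_(j < r) (f j)@_(a j).
Proof.
rewrite /tensor mcoeff_sum; set D := \big[fsetU/fset0]_(j < r) _.
have [/forallP aD|/forallPn[j aj]] := boolP [forall j, a j \in D]; last first.
  rewrite [RHS](bigD1 j) //= [X in _ = X * _]mcoeff_outdom ?mul0r; last first.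
    apply: contra aj => aj; apply/bigfcupP; exists j => //.
    by rewrite mem_index_enum.
  rewrite big1 // => a' _; rewrite mcoeffU; case: eqP => // e; case/negP: aj.
  by rewrite -e ffunE (valP (a' j)).
pose a' : {ffun 'I_r -> D} := [ffun j => [` aD j]%fset].
have a'E : [ffun j => val (a' j)] = a by apply/ffunP=> j; rewrite !ffunE.
rewrite (bigD1 a') //= a'E mcoeffU eqxx mulr1n [X in _ + X]big1 ?addr0 => [|d da].
  by apply: eq_bigr => j _; congr (_ @_ _); rewrite ffunE.
rewrite mcoeffU; case: eqP => // e; case/eqP: da.
by apply/ffunP=> j; apply: val_inj; rewrite ffunE /= -e ffunE.
Qed.

End LinextLemmas.

(** Linear extensions commute with the base change from the integers. *)
Lemma mcoeff_linext_intr (K : comPzRingType) (A B : choiceType)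
    (FK : A -> {malg K[B]}) (FZ : A -> {malg int[B]}) fK fZ b :
  (forall a, fK@_a = (fZ@_a)%:~R) -> (forall a b, (FK a)@_b = ((FZ a)@_b)%:~R) ->
  (linext FK fK)@_b = ((linext FZ fZ)@_b)%:~R.
Proof.
move=> fE FE; have s : {subset msupp fK <= msupp fZ}.
  by move=> a; rewrite -!mcoeff_neq0 fE; apply: contraNneq => ->.
rewrite (linextEw FK s) mcoeff_linext mcoeff_sum rmorph_sum /=.
by apply: eq_bigr => a _; rewrite mcoeff_mscale fE FE rmorphM.
Qed.

(** * Rooted trees on initial segments of the natural numbers *)

(** Trees of different sizes are compared through natural numbers, so that no
    transport between ordinal types of equal size is needed.  An alias of tag
    keeps the sizes syntactically uniform for linear arithmetic. *)
Definition tsize (t : tree) : nat := tag t.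

Lemma ltn_tree (t : tree) (i : 'I_(tag t)) : (i < tsize t)%N.
Proof. exact: ltn_ord. Qed.

Definition nroot (t : tree) : nat := root (tagged t).

Definition npar (t : tree) (k : nat) : nat :=
  if insub k is Some i then parent (tagged t) i : nat else 0%N.

Lemma nparE (t : tree) (i : 'I_(tag t)) : npar t i = parent (tagged t) i.
Proof. by rewrite /npar valK. Qed.

Lemma nroot_lt t : (nroot t < tsize t)%N.
Proof. exact: ltn_ord. Qed.

Lemma npar_lt t k : (k < tsize t)%N -> (npar t k < tsize t)%N.
Proof. by move=> kt; rewrite (nparE (Ordinal kt)). Qed.

Lemma npar_root t : npar t (nroot t) = nroot t.
Proof. by rewrite nparE parent_root. Qed.

Lemma tree_ext (a b : tree) : tsize a = tsize b -> nroot a = nroot b ->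
  (forall k, (k < tsize a)%N -> npar a k = npar b k) -> a = b.
Proof.
case: a b => n a [m b] /= e; case: m / e b => b ab pab; congr Tagged.
apply: val_inj; rewrite [val a]surjective_pairing [val b]surjective_pairing.
congr pair; first exact: val_inj.
apply/ffunP=> k; apply: val_inj.
by have := pab k (ltn_ord k); rewrite (@nparE (Tagged RT a)) (@nparE (Tagged RT b)).
Qed.

(** Induction along the path to the root. *)
Lemma tree_ind (t : tree) (P : nat -> Prop) : P (nroot t) ->
  (forall k, (k < tsize t)%N -> k <> nroot t -> P (npar t k) -> P k) ->
  forall k, (k < tsize t)%N -> P k.
Proof.
move=> P0 PS k kt; have /iter_findex := connect_root (tagged t) (Ordinal kt).
move: (findex _ _ _) => n; elim: n k kt => [|n IHn] k kt.
  by move/(congr1 val)=> /= ->.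
rewrite iterSr => h; have [-> //|nk] := eqVneq k (nroot t).
apply: PS => //; first exact/eqP.
have pk := npar_lt kt; apply: (IHn _ pk); rewrite -h; congr (iter n _ _).
by apply: val_inj; rewrite /= (nparE (Ordinal kt)).
Qed.

Lemma npar_fix t k : (k < tsize t)%N -> npar t k = k -> k = nroot t.
Proof.
move=> kt; apply: (@tree_ind t (fun k => npar t k = k -> k = nroot t)) kt => //.
by move=> l lt nl IH e; case: nl; rewrite e in IH; apply: IH.
Qed.

(** The last condition is acyclicity. *)
Lemma tree_build n r (q : nat -> nat) : (r < n)%N -> q r = r ->
    (forall k, (k < n)%N -> (q k < n)%N) ->
    (forall k, (k < n)%N -> exists l, iter l q k = r) ->
  exists s : tree, [/\ tsize s = n, nroot s = r & forall k, (k < n)%N -> npar s k = q k].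
Proof.
move=> rn qr qn qc; pose Q := [ffun k : 'I_n => insubd (Ordinal rn) (q k)].
have QE k : val (Q k) = q k by rewrite ffunE val_insubd qn.
have isr : is_rt (Ordinal rn, Q).
  apply/andP; split; first by apply/eqP/val_inj; rewrite QE.
  apply/forallP=> -[k kn]; have [l] := qc k kn.
  elim: l k kn => [|l IHl] k kn.
    by move=> /= e; rewrite (_ : Ordinal kn = Ordinal rn) ?connect0 //; apply: val_inj.
  rewrite iterSr => /IHl - /(_ (qn _ kn)); apply: connect_trans.
  by apply/connect1/eqP/val_inj; rewrite QE.
exists (Tagged RT (MkRT isr)); split=> // k kn.
by rewrite (@nparE (Tagged RT (MkRT isr)) (Ordinal kn)) /= /parent /= QE.
Qed.

(** * Partial composition *)

(** Substituting a tree with m vertices for the vertex p moves the vertices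
    after p by m - 1.  At p itself the value is meaningless. *)
Definition spread (p m x : nat) : nat := if (x < p)%N then x else (x + m).-1.

(** The map on vertices that contracts the block [p, p + m) to p; it is inverse
    to spread away from p. *)
Definition collapse (p m y : nat) : nat :=
  if (y < p)%N then y else if (y < p + m)%N then p else (y.+1 - m)%N.

(** T is one of the terms of the partial composition of t into the vertex p of
    s.  The last two clauses only say where the new parents lie after the
    contraction of the block of t: an edge of s ending at p may end at any
    vertex of this block. *)
Definition inserts (p : nat) (t s T : tree) : Prop :=
  [/\ ((tsize T).+1 = tsize s + tsize t)%N,
      nroot T = if nroot s == p then (p + nroot t)%N else spread p (tsize t) (nroot s),
      forall k, (k < tsize t)%N -> k <> nroot t -> npar T (p + k) = (p + npar t k)%N,
      collapse p (tsize t) (npar T (p + nroot t)) = npar s p &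
      forall x, (x < tsize s)%N -> x <> p ->
        collapse p (tsize t) (npar T (spread p (tsize t) x)) = npar s x].

Section SubstNat.
Variables (s t : tree) (p : 'I_(tag s)) (f : {ffun incoming (tagged s) p -> 'I_(tag t)}).
Let T : tree := Tagged RT (subst (i := p) (tagged t) f).

Lemma val_inner (k : 'I_(tag t)) : inner p k = (p + k)%N :> nat.
Proof. by []. Qed.

Lemma val_outer d (j : 'I_(tag s)) :
  outer (i := p) (n := tsize t) d j =
    (if j == p then val d else spread p (tsize t) j) :> nat.
Proof.
case: eqP => [->|/eqP jp]; first by rewrite outer_at.
rewrite /outer /spread; case: splitP => [q e|q e].
  case: splitP => [a ea|a ea] /=.
    by rewrite /= in e; rewrite e ea ltn_ord.
  by case/eqP: jp; apply: val_inj; move: e; rewrite /= ea; case: a {ea} => -[]//= _; lia.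
move: e => /= e; have := ltn_tree p; rewrite e; case: ifP => /=; lia.
Qed.

Lemma nroot_subst : nroot T =
  if nroot s == p then (p + nroot t)%N else spread p (tsize t) (nroot s).
Proof.
rewrite /nroot /T /root /= /newroot val_outer /=.
by rewrite -val_eqE.
Qed.

Lemma npar_subst_inner k : (k < tsize t)%N -> npar T (p + k) =
  if k == nroot t then (if npar s p == p then p + nroot t else spread p (tsize t) (npar s p))%N
  else (p + npar t k)%N.
Proof.
move=> kt; have e : (p + k)%N = inner p (Ordinal kt) :> nat by [].
rewrite e (@nparE T) /= /parent /= newparent_inner /parent_inner -val_eqE /=.
case: ifP => kr.
  by rewrite val_outer nparE -val_eqE.
by rewrite val_inner (nparE (Ordinal kt)).
Qed.

Lemma npar_subst_outer (x : 'I_(tag s)) : x != p ->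
  npar T (spread p (tsize t) x) =
    if insub x is Some e then (p + f e)%N else spread p (tsize t) (npar s x).
Proof.
move=> xp.
have e : spread p (tsize t) x =
    outer (i := p) (n := tsize t) (inner p (root (tagged t))) x.
  by rewrite val_outer (negPf xp).
rewrite e (@nparE T) /= /parent /= newparent_outer // /parent_outer.
case: insubP => // xin; rewrite val_outer nparE; case: eqP => // e'.
case/negP: xin; rewrite e' eqxx andbT; apply/eqP=> xr.
by case/eqP: xp; rewrite -e' xr parent_root.
Qed.

End SubstNat.

Lemma spreadK p m x : (0 < m)%N -> x <> p -> collapse p m (spread p m x) = x.
Proof.
by rewrite /collapse /spread => m0 xp; case: (ltnP x p) => h; do ?case: ifP; lia.
Qed.

Lemma collapseK p m y : (0 < m)%N -> collapse p m y <> p -> spread p m (collapse p m y) = y.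
Proof. by rewrite /collapse /spread => m0; do ?case: ifP; lia. Qed.

Lemma collapse_block p m k : (k < m)%N -> collapse p m (p + k) = p.
Proof. by rewrite /collapse => m0; do ?case: ifP; lia. Qed.

Lemma collapseP p m y : (0 < m)%N -> collapse p m y = p ->
  exists2 k, (k < m)%N & y = (p + k)%N.
Proof.
by rewrite /collapse => m0 h; exists (y - p)%N; move: h; do ?case: ifP; lia.
Qed.

Lemma tsize_gt0 (t : tree) : (0 < tsize t)%N.
Proof. exact: leq_trans (nroot_lt t). Qed.

Lemma inserts_subst (s t : tree) (p : 'I_(tag s))
    (f : {ffun incoming (tagged s) p -> 'I_(tag t)}) :
  inserts p t s (Tagged RT (subst (i := p) (tagged t) f)).
Proof.
have m0 := tsize_gt0 t.
split.
- by rewrite [tsize _](_ : _ = p + tsize t + (tsize s - p.+1))%N //; have := ltn_tree p; lia.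
- exact: nroot_subst.
- by move=> k kt /eqP nk; rewrite npar_subst_inner // (negPf nk).
- rewrite npar_subst_inner ?nroot_lt // eqxx.
  by case: eqP => [->|nk]; [rewrite collapse_block ?nroot_lt | rewrite spreadK].
move=> x xs xp; have xp' : Ordinal xs != p by apply/eqP=> e; case: xp; rewrite -e.
rewrite (npar_subst_outer f xp') (nparE (Ordinal xs)).
case: insubP => [e|].
  by rewrite collapse_block // => /andP[_ /eqP ->].
rewrite negb_and negbK -(rwP orP) => -[/eqP e|e]; last first.
  by rewrite spreadK // => /val_inj e'; rewrite e' eqxx in e.
by rewrite e parent_root -e spreadK.
Qed.

(** The attaching map f is read off from T: an edge entering p ends in T at a
    vertex of the block of t. *)
Lemma subst_of_inserts (s t T : tree) (p : 'I_(tag s)) : inserts p t s T ->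
  exists f : {ffun incoming (tagged s) p -> 'I_(tag t)},
    Tagged RT (subst (i := p) (tagged t) f) = T.
Proof.
move=> hT; have m0 := tsize_gt0 t.
have f_lt (e : incoming (tagged s) p) :
    (npar T (spread p (tsize t) (val e)) - p < tsize t)%N &&
    (p <= npar T (spread p (tsize t) (val e)))%N.
  have [_ _ _ _ hx] := hT; case: e => x /= /andP[xr /eqP xp].
  have xp' : x <> p :> nat.
    move/val_inj=> e; move: xr; rewrite e in xp *.
    rewrite -val_eqE /= -/(nroot s) => /eqP; apply.
    by apply: npar_fix; rewrite // nparE xp.
  have := hx x (ltn_tree x) xp'; rewrite nparE xp => /collapseP[//|k km ->].
  by rewrite addKn km leq_addr.
pose f := [ffun e : incoming (tagged s) p =>
  insubd (root (tagged t)) (npar T (spread p (tsize t) (val e)) - p)%N].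
exists f; set T' := Tagged RT _; have hT' : inserts p t s T' by exact: inserts_subst.
have [e1 e2 e3 e4 e5] := hT; have [e1' e2' e3' e4' e5'] := hT'.
have ps := ltn_tree p.
apply: tree_ext; [lia | by rewrite e2 | move=> k kT].
have [kp|kp] := eqVneq (collapse p (tsize t) k) p.
  have [l lm ->] := collapseP m0 kp; have [-> {l lm}|/eqP nl] := eqVneq l (nroot t).
    (* The root of the block of t: its parent is outside the block, and thus
       determined by the contraction, unless p is the root of s. *)
    have [e|/eqP ne] := eqVneq (npar s p) p.
      rewrite e in e4 e4'.
      have rs : nroot s = p by rewrite (npar_fix _ e).
      rewrite rs eqxx in e2 e2'.
      by rewrite -{1}e2' -{1}e2 !npar_root e2 e2'.
    have n1 : collapse p (tsize t) (npar T' (p + nroot t)) <> p by rewrite e4'.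
    have n2 : collapse p (tsize t) (npar T (p + nroot t)) <> p by rewrite e4.
    by rewrite -(collapseK m0 n1) -(collapseK m0 n2) e4 e4'.
  by rewrite e3 // e3'.
move/eqP in kp; rewrite -(collapseK m0 kp); set x := collapse _ _ _ in kp *.
have xs : (x < tsize s)%N by move: kp; rewrite /x /collapse; do ?case: ifP; lia.
have [e|/eqP ne] := eqVneq (npar s x) p; last first.
  have n1 : collapse p (tsize t) (npar T' (spread p (tsize t) x)) <> p by rewrite e5'.
  have n2 : collapse p (tsize t) (npar T (spread p (tsize t) x)) <> p by rewrite e5.
  by rewrite -(collapseK m0 n1) -(collapseK m0 n2) e5 // e5'.
have xp' : Ordinal xs != p by apply/eqP=> ex; case: kp; rewrite -ex.
rewrite (npar_subst_outer f xp'); case: insubP => [z zin zx|].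
  rewrite /f ffunE val_insubd; have /andP[-> le] := f_lt z.
  by rewrite subnKC // zx.
rewrite negb_and negbK => /orP[/eqP xr|].
  have ex : x = nroot s by rewrite -[x]/(val (Ordinal xs)) xr.
  by case: kp; rewrite -e ex npar_root.
by case/eqP; apply: val_inj; rewrite -[RHS]e (nparE (Ordinal xs)).
Qed.

Lemma subst_inj (s t : tree) (p : 'I_(tag s))
    (f f' : {ffun incoming (tagged s) p -> 'I_(tag t)}) :
  Tagged RT (subst (i := p) (tagged t) f) =
  Tagged RT (subst (i := p) (tagged t) f') -> f = f'.
Proof.
move=> e; apply/ffunP=> z; apply: val_inj; have /andP[zr zp] := valP z.
have zp' : val z != p.
  apply: contraNneq zr => zp'; rewrite zp' in zp *; rewrite -val_eqE.
  by apply/eqP/(@npar_fix s); rewrite ?nparE ?(eqP zp) ?ltn_tree.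
have := npar_subst_outer f zp'; have := npar_subst_outer f' zp'; rewrite e => ->.
case: insubP => [z' _ ez|]; last by rewrite zr zp.
by rewrite (val_inj ez) => /addnI.
Qed.

(** The attaching map is determined by the tree it produces, hence every term
    of the partial composition has coefficient one. *)
Lemma mcoeff_partial_comp (K : comPzRingType) p (t s T : tree) : (p < tsize s)%N ->
  (partial_comp K p t s)@_T = `[< inserts p t s T >]%:R.
Proof.
move=> ps; rewrite /partial_comp insubT raddf_sum /=.
under eq_bigr do rewrite mcoeffU.
have [|nT] := asboolP (inserts p t s T); last first.
  rewrite big1 // => f _; case: eqP => // e; case: nT; rewrite -e.
  exact: (@inserts_subst s t (Sub p ps) f).
move/(@subst_of_inserts s t T (Sub p ps)) => [f <-].
rewrite (bigD1 f) //= eqxx big1 ?addr0 // => f' ff'.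
case: eqP => // e; case/eqP: ff'.
exact: (@subst_inj s t (Sub p ps)) e.
Qed.

(** s is the contraction of T along the block of t. *)
Lemma inserts_inj p (t s s' T : tree) : inserts p t s T -> inserts p t s' T ->
  (p < tsize s)%N -> s = s'.
Proof.
have m0 := tsize_gt0 t.
case=> a1 a2 a3 a4 a5 [b1 b2 b3 b4 b5] ps.
apply: tree_ext; first lia.
  have : collapse p (tsize t) (nroot T) = nroot s.
    by rewrite a2; case: eqP => [->|n]; [rewrite collapse_block ?nroot_lt | rewrite spreadK].
  rewrite b2; case: eqP => [->|n]; first by rewrite collapse_block ?nroot_lt.
  by rewrite spreadK.
move=> k ks; have [->|/eqP kp] := eqVneq k p; first by rewrite -a4 b4.
by rewrite -a5 // b5 //; lia.
Qed.

(** Conversely the contraction exists as soon as T induces t on the block and no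
    edge but that of the root of t leaves it.  It is again a tree because the
    contraction of a path to the root is a path to the root with repetitions. *)
Lemma ex_contraction p (t T : tree) : (p + tsize t <= tsize T)%N ->
  (forall k, (k < tsize t)%N -> k <> nroot t -> npar T (p + k) = (p + npar t k)%N) ->
  (forall k, nroot T = (p + k)%N -> (k < tsize t)%N -> k = nroot t) ->
  exists2 s : tree, (p < tsize s)%N & inserts p t s T.
Proof.
move=> pT h1 h2; have m0 := tsize_gt0 t.
set m := tsize t in m0 pT *; pose r := collapse p m (nroot T).
(* A section of the contraction: the vertex p is represented by the root of t,
   the vertex of the block whose outgoing edge leaves it. *)
pose sg x := if x == p then (p + nroot t)%N else spread p m x.
pose q x := collapse p m (npar T (sg x)).
have qE x : q x = collapse p m (npar T (sg x)) by [].
have sgT x : (x < (tsize T).+1 - m)%N -> (sg x < tsize T)%N.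
  rewrite /sg /spread /m; have := nroot_lt t; case: eqP => //; first lia.
  by case: ifP; lia.
have collapse_lt y : (y < tsize T)%N -> (collapse p m y < (tsize T).+1 - m)%N.
  by rewrite /collapse /m; do ?case: ifP; lia.
have sgr : sg r = nroot T.
  rewrite /sg; case: eqP => rp; last by rewrite collapseK.
  by have [k kt ke] := collapseP m0 rp; rewrite ke (h2 k).
have [||||s [s1 s2 s3]] := @tree_build ((tsize T).+1 - m) r q.
- exact/collapse_lt/nroot_lt.
- by rewrite /q sgr npar_root.
- by move=> k kT; apply/collapse_lt/npar_lt/sgT.
- suff hy y : (y < tsize T)%N -> exists l, iter l q (collapse p m y) = r.
    move=> k kT; have [l] := hy _ (sgT _ kT); rewrite /sg; case: eqP => [->|kp].
      by rewrite collapse_block ?nroot_lt // => <-; exists l.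
    by rewrite spreadK // => <-; exists l.
  apply: (@tree_ind T (fun y => exists l, iter l q (collapse p m y) = r)); first by exists 0.
  move=> k kT kr [l el].
  have [kp|/eqP kp] := eqVneq (collapse p m k) p.
    have [i im ek] := collapseP m0 kp.
    have [ei|/eqP ei] := eqVneq i (nroot t).
      by exists l.+1; rewrite iterSr qE kp /sg eqxx -ei -ek.
    exists l; rewrite -el ek; congr iter; rewrite h1 // !collapse_block //.
    exact: npar_lt.
  by exists l.+1; rewrite iterSr qE /sg; case: eqP => // _; rewrite collapseK.
have ps : (p < tsize s)%N by lia.
exists s => //; split.
- by rewrite -/m; lia.
- by rewrite s2; exact: esym sgr.
- exact: h1.
- by rewrite s3 /q /sg ?eqxx // -s1.
- by move=> x xs /eqP xp; rewrite s3 -?s1 // /q /sg (negPf xp).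
Qed.

(** * Simultaneous composition *)

Lemma collapse_nroot p t s T : inserts p t s T -> collapse p (tsize t) (nroot T) = nroot s.
Proof.
case=> _ -> _ _ _; case: eqP => [->|n]; first by rewrite collapse_block ?nroot_lt.
by rewrite spreadK // tsize_gt0.
Qed.

(** The first vertex of the j-th block. *)
Fixpoint offset (ts : nat -> tree) (j : nat) : nat :=
  if j is j'.+1 then (offset ts j' + tsize (ts j'))%N else 0%N.

Lemma offsetS ts j : offset ts j.+1 = (offset ts j + tsize (ts j))%N.
Proof. by []. Qed.

Lemma leq_offset ts : {homo offset ts : i j / (i <= j)%N}.
Proof. by apply: homo_leq => // [? ? ?|i]; [exact: leq_trans | rewrite offsetS leq_addr]. Qed.

Lemma leq_offset_id ts j : (j <= offset ts j)%N.
Proof. by elim: j => // j IHj; have := tsize_gt0 (ts j); rewrite offsetS; lia. Qed.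

Lemma offset_id ts i : (forall j, (j < i)%N -> tsize (ts j) = 1%N) ->
  forall j, (j <= i)%N -> offset ts j = j.
Proof. by move=> h; elim=> // j IHj ji; rewrite offsetS h ?IHj ?addn1 // ltnW. Qed.

(** T is one of the terms of the simultaneous composition of u with
    ts 0, ts 1, ...: it induces ts j on the j-th block, and the edge leaving
    the root of this block ends somewhere in the block of the parent of j.  At
    the root of u this condition holds trivially. *)
Definition composes (u : tree) (ts : nat -> tree) (T : tree) : Prop :=
  [/\ tsize T = offset ts (tsize u),
      nroot T = (offset ts (nroot u) + nroot (ts (nroot u)))%N,
      forall j k, (j < tsize u)%N -> (k < tsize (ts j))%N -> k <> nroot (ts j) ->
        npar T (offset ts j + k) = (offset ts j + npar (ts j) k)%N &
      forall j, (j < tsize u)%N ->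
        (offset ts (npar u j) <= npar T (offset ts j + nroot (ts j)) < offset ts (npar u j).+1)%N].

Section Step.
Variables (u t : tree) (ts ts' : nat -> tree) (i : nat).
Hypothesis iu : (i < tsize u)%N.
Hypothesis ts_one : forall j, (j <= i)%N -> tsize (ts j) = 1%N.
Hypothesis ts'i : ts' i = t.
Hypothesis ts'j : forall j, j <> i -> ts' j = ts j.

Let m := tsize t.
Let m0 : (0 < m)%N := tsize_gt0 t.

Let offset_le j : (j <= i.+1)%N -> offset ts j = j.
Proof. by move=> ji; apply: offset_id ji => k; rewrite ltnS; apply: ts_one. Qed.

Let offset'_le j : (j <= i)%N -> offset ts' j = j.
Proof.
move=> ji; apply: offset_id ji => k ki; rewrite ts'j; last lia.
by apply: ts_one; apply: ltnW.
Qed.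

Let offset'_gt j : (i < j)%N -> (offset ts' j).+1 = (offset ts j + m)%N.
Proof.
elim: j => // j IHj; rewrite ltnS leq_eqVlt => /orP[/eqP <-|ij].
  by rewrite offsetS offset'_le // ts'i offset_le //; lia.
by rewrite !offsetS ts'j; [have := IHj ij; lia | lia].
Qed.

Let offset_gt j : (i < j)%N -> (i < offset ts j)%N.
Proof. by move=> ij; apply: leq_trans (leq_offset_id ts j). Qed.

Let spread_offset j k : j <> i -> (k < tsize (ts j))%N ->
  [/\ spread i m (offset ts j + k) = (offset ts' j + k)%N,
      collapse i m (offset ts' j + k) = (offset ts j + k)%N & (offset ts j + k)%N <> i].
Proof.
move=> ji kj; rewrite /spread /collapse; case: (ltngtP j i) => // h.
  rewrite ts_one in kj; last exact: ltnW.
  by rewrite offset_le ?offset'_le; try lia; split; do ?case: ifP; lia.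
have := offset'_gt h; have := offset_gt h.
by split; do ?case: ifP; lia.
Qed.

Let block_collapse l y :
  (offset ts l <= collapse i m y < offset ts l.+1)%N =
  (offset ts' l <= y < offset ts' l.+1)%N.
Proof.
case: (ltngtP l i) => h.
- rewrite !offset_le ?offset'_le; try lia.
  by rewrite /collapse; do ?case: ifP; lia.
- have := offset'_gt h; have := offset_gt h; have := @offset'_gt l.+1; have := @offset_gt l.+1.
  by rewrite /collapse; do ?case: ifP; lia.
have := offset'_gt (ltnSn i); rewrite h (offset_le (leqnSn i)) (offset_le (leqnn i.+1)).
rewrite (offset'_le (leqnn i)) /collapse; do ?case: ifP; lia.
Qed.

Let nroot_one j : (j <= i)%N -> nroot (ts j) = 0%N.
Proof. by move=> ji; have := nroot_lt (ts j); rewrite ts_one //; lia. Qed.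

(** Associativity: filling the vertex i of u by t amounts to inserting t into a
    composite in which the vertices up to i are still unfilled, that is,
    filled by one-vertex trees.  Both conditions on parents are checked after
    the contraction of the block of t. *)
Lemma composes_inserts s T : inserts i t s T -> (composes u ts s <-> composes u ts' T).
Proof.
move=> h; have [a1 a2 a3 a4 a5] := h; have er := collapse_nroot h.
have ru := nroot_lt u; rewrite -/m in a1 a2 a4 a5 er.
have offu := offset'_gt iu.
have sn j k : (j < tsize u)%N -> (k < tsize (ts j))%N -> (offset ts j + k < offset ts (tsize u))%N.
  move=> ju kj; have := @leq_offset ts j.+1 (tsize u) ju; rewrite offsetS; lia.
split=> -[b1 b2 b3 b4]; split.
- by lia.
- rewrite a2; have [e|/eqP e] := eqVneq (nroot u) i.
    have -> : nroot s = i by rewrite b2 e offset_le // nroot_one // addn0.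
    by rewrite eqxx e offset'_le // ts'i.
  have [c1 _ c3] := spread_offset e (nroot_lt _).
  by rewrite b2; case: eqP => // _; rewrite c1 ts'j.
- move=> j k ju; have [->|/eqP e] := eqVneq j i.
    by rewrite ts'i offset'_le //; apply: a3.
  rewrite ts'j // => kj kn.
  have [c1 _ c3] := spread_offset e kj; have [d1 _ d3] := spread_offset e (npar_lt kj).
  rewrite -c1 -d1 -b3 // -a5 //; last by rewrite b1; apply: sn.
  by rewrite collapseK // a5 // ?b3 // b1; apply: sn.
- move=> j ju; rewrite -block_collapse.
  have [->|/eqP e] := eqVneq j i.
    rewrite ts'i (offset'_le (leqnn i)) a4; have := b4 i iu.
    by rewrite (offset_le (leqnSn i)) nroot_one // addn0.
  rewrite ts'j //; have [c1 _ c3] := spread_offset e (nroot_lt _).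
  by rewrite -c1 a5 //; [apply: b4 | rewrite b1; apply: sn => //; apply: nroot_lt].
- by lia.
- rewrite -er b2; have [e|/eqP e] := eqVneq (nroot u) i.
    by rewrite e offset'_le // ts'i collapse_block ?nroot_lt // offset_le // nroot_one // addn0.
  by rewrite ts'j //; have [_ -> _] := spread_offset e (nroot_lt _).
- move=> j k ju kj kn; have [e|/eqP e] := eqVneq j i.
    by move: kj kn; rewrite e ts_one // nroot_one //; lia.
  have [c1 _ c3] := spread_offset e kj; have [_ d1 d3] := spread_offset e (npar_lt kj).
  have ks : (offset ts j + k < tsize s)%N by have := sn j k ju kj; lia.
  by rewrite -a5 // c1 -ts'j // b3 ?ts'j.
move=> j ju; have [e|/eqP e] := eqVneq j i.
  rewrite e (offset_le (leqnSn i)) nroot_one // addn0 -a4 block_collapse.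
  by have := b4 i iu; rewrite ts'i (offset'_le (leqnn i)).
have [c1 _ c3] := spread_offset e (nroot_lt _).
have ks : (offset ts j + nroot (ts j) < tsize s)%N.
  by have := sn j _ ju (nroot_lt _); lia.
by rewrite -a5 // block_collapse c1 -ts'j //; apply: b4.
Qed.

Lemma composes_ex_contraction T : composes u ts' T ->
  exists2 s : tree, (i < tsize s)%N & inserts i t s T.
Proof.
case=> b1 b2 b3 b4; apply: ex_contraction.
- have := @leq_offset ts' i.+1 _ iu; rewrite b1 offsetS ts'i offset'_le //.
- by move=> k kt kn; have := b3 i k iu; rewrite ts'i offset'_le // => ->.
move=> k ek kt; rewrite b2 in ek.
have := nroot_lt (ts' (nroot u)).
case: (ltngtP (nroot u) i) => h.
- have := @leq_offset ts' _ _ h; rewrite offsetS [offset _ i]offset'_le //; lia.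
- have := @leq_offset ts' _ _ h; rewrite offsetS [offset _ i]offset'_le // ts'i -/m; lia.
by move: ek; rewrite h ts'i offset'_le //; lia.
Qed.

End Step.

Lemma unit_tree_subproof : is_rt (ord0 : 'I_1, [ffun=> ord0]).
Proof.
apply/andP; split=> /=; first by rewrite ffunE.
by apply/forallP=> j; rewrite (ord1 j); apply: connect0.
Qed.

Definition unit_tree : tree := Tagged RT (MkRT unit_tree_subproof).

(** The trees inserted so far when the vertices of u are filled from the last
    one down to the i-th. *)
Definition pad (i : nat) (l : seq tree) (j : nat) : tree :=
  if (j < i)%N then unit_tree else nth unit_tree l (j - i).

Lemma tsize_unit : tsize unit_tree = 1%N. Proof. by []. Qed.

Lemma composes_unit u T : composes u (fun _ => unit_tree) T <-> T = u.
Proof.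
have o j : offset (fun _ => unit_tree) j = j by apply: (@offset_id _ j).
have r1 : nroot unit_tree = 0%N by have := nroot_lt unit_tree; rewrite tsize_unit; lia.
split=> [[]|->].
  rewrite !o r1 addn0 => b1 b2 _ b4.
  apply: tree_ext => // k kT; rewrite b1 in kT.
  by have := b4 k kT; rewrite !o addn0; lia.
rewrite /composes !o r1 addn0; split=> // [j k _|j ju].
  by move: r1; rewrite tsize_unit; lia.
by rewrite !o addn0; lia.
Qed.

(** Each insertion is undone by a unique contraction, so all the terms of the
    iterated composition have coefficient one. *)
Lemma mcoeff_comp_from (K : comPzRingType) u l i T : (i + size l = tsize u)%N ->
  (comp_from i l (<< u >> : {malg K[tree]}))@_T = `[< composes u (pad i l) T >]%:R.
Proof.
elim: l i T => [|t l IHl] i T /=.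
  move=> _; rewrite mcoeffU; congr (_ *+ _); congr nat_of_bool.
  have -> : pad i [::] = fun _ => unit_tree.
    by apply/funext=> j; rewrite /pad nth_nil if_same.
  case: asboolP => [/composes_unit ->|h]; first by rewrite eqxx.
  by case: eqP => // e; case: h; apply/composes_unit.
rewrite addnS -addSn => il; set g := comp_from _ _ _.
have gE S : g@_S = `[< composes u (pad i.+1 l) S >]%:R by apply: IHl.
have iu : (i < tsize u)%N by lia.
have ts_one j : (j <= i)%N -> tsize (pad i.+1 l j) = 1%N by rewrite /pad ltnS => ->.
have ts'i : pad i (t :: l) i = t by rewrite /pad ltnn subnn.
have ts'j j : j <> i -> pad i (t :: l) j = pad i.+1 l j.
  rewrite /pad ltnS => ji; case: (ltngtP j i) => // ij.
  by rewrite -[(j - i)%N]prednK ?subn_gt0 //= subnS.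
have step := composes_inserts iu ts_one ts'i ts'j.
have gs S : S \in msupp g -> composes u (pad i.+1 l) S /\ (i < tsize S)%N.
  rewrite -mcoeff_neq0 gE; case: asboolP => [h|_]; last by rewrite eqxx.
  move=> _; split=> //; have [-> _ _ _] := h.
  exact: leq_trans (leq_offset_id _ _).
have [hT|hT] := asboolP (composes u (pad i (t :: l)) T).
  have [S iS hS] := composes_ex_contraction iu ts_one ts'i ts'j hT.
  rewrite (@mcoeff_linext1 _ _ _ _ _ _ S) => [|S' /gs[_ iS'] SS'].
    rewrite mcoeff_partial_comp // gE.
    have /(step _ _ hS) h := hT.
    by rewrite !asboolT // mulr1.
  rewrite mcoeff_partial_comp //; case: asboolP => // hS'.
  by case/eqP: SS'; apply: inserts_inj hS' hS iS'.
rewrite mcoeff_linext0 // => S /gs[hS iS]; rewrite mcoeff_partial_comp //.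
by case: asboolP => // /step h; case: hT; apply/h.
Qed.

(** * Composites along a bijection of vertices *)

Section Composite.
Variables (Y : choiceType) (r : nat).

(** The vertices of a composite of u with the family bs, before they are
    numbered.  Families are functions rather than finite functions, so that
    the vertex types of a family and of the family obtained by acting on its
    members are convertible. *)
Definition vtx (bs : 'I_r -> lab Y) : finType := {j : 'I_r & 'I_(tag (bs j))}.

Definition mkvtx (bs : 'I_r -> lab Y) j (k : 'I_(tag (bs j))) : vtx bs :=
  Tagged (fun j => 'I_(tag (bs j))) k.

(** The condition on the parent of the root of a block names only the block in
    which this parent lies.  For the block of the root of u the condition
    follows from the one on the root of the composite. *)
Definition vertex_ok (u : RT r) (bs : 'I_r -> lab Y) M (phi : {ffun vtx bs -> 'I_M})
    (w : word Y M) (x : vtx bs) : bool :=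
  (w.2 (phi x) == letter (bs (tag x)) (tagged x)) &&
  if tagged x == root (ltree (bs (tag x))) then
    [exists y : vtx bs, (tag y == parent u (tag x)) && (parent w.1 (phi x) == phi y)]
  else parent w.1 (phi x) == phi (mkvtx (parent (ltree (bs (tag x))) (tagged x))).

Definition composite (u : RT r) (bs : 'I_r -> lab Y) M (phi : {ffun vtx bs -> 'I_M})
    (w : word Y M) : bool :=
  [&& injectiveb phi, #|vtx bs| == M,
      root w.1 == phi (mkvtx (root (ltree (bs (root u))))) &
      [forall x, vertex_ok u phi w x]].

End Composite.

Section CompLab.
Variables (X : choiceType) (b : lab (lab X)).
Let r := tag b.
Let u := ltree b.
Let bs : 'I_r -> lab X := letter b.

(** The standard numbering: the blocks one after the other. *)
Definition block_rank : {ffun vtx bs -> 'I_(width b)} := [ffun x => tagnat.rank x].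

Let l := [seq Tagged RT (ltree (bs j)) | j <- enum 'I_r].

Let padE (j : 'I_r) : pad 0 l j = Tagged RT (ltree (bs j)).
Proof.
rewrite /pad ltn0 subn0 (nth_map j); first by rewrite nth_ord_enum.
by rewrite size_enum_ord.
Qed.

Let offsetE j : (j <= r)%N -> offset (pad 0 l) j = (\sum_(i < r | (i < j)%N) tag (bs i))%N.
Proof.
elim: j => [|j IHj] jr; first by rewrite big_pred0.
rewrite offsetS IHj; last exact: ltnW.
rewrite [RHS](bigD1 (Ordinal jr)) //= addnC.
have -> : tsize (pad 0 l j) = tag (bs (Ordinal jr)).
  by rewrite -[j]/(val (Ordinal jr)) padE.
congr (_ + _)%N; apply: eq_bigl => i.
by rewrite -val_eqE /= ltnS ltn_neqAle andbC.
Qed.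

Let block_rankE (j : 'I_r) (k : 'I_(tag (bs j))) :
  (offset (pad 0 l) j + k)%N = block_rank (mkvtx k) :> nat.
Proof. by rewrite /block_rank ffunE tagnat.rankEsum offsetE // ltnW. Qed.

Lemma block_rank_inj : injective block_rank.
Proof. by move=> x y; rewrite !ffunE; apply: tagnat.rank_inj. Qed.

Lemma card_vtx : #|vtx bs| = width b.
Proof. exact: tagnat.card. Qed.

Let widthE : width b = offset (pad 0 l) r.
Proof. by rewrite offsetE //; apply: eq_bigl => i; rewrite ltn_ord. Qed.

Let composes_composite (w : word X (width b)) :
  composes (Tagged RT u) (pad 0 l) (Tagged RT w.1) ->
  w.2 = [ffun k => letter (bs (tagnat.sig1 k)) (tagnat.sig2 k)] -> composite u block_rank w.
Proof.
case=> [b1 b2 b3 b4] w2; apply/and4P; split.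
- apply/injectiveP/block_rank_inj.
- by rewrite card_vtx.
- apply/eqP/val_inj => /=; rewrite -block_rankE; move: b2; rewrite (padE (root u)); exact.
apply/forallP=> -[j k]; apply/andP; split.
  by rewrite w2 ffunE /block_rank ffunE /tagnat.sig1 /tagnat.sig2 tagnat.rankK.
set x : vtx bs := existT _ _ _; rewrite -[x]/(mkvtx k) /=.
have e1 := @nparE (Tagged RT w.1) (block_rank (mkvtx k)).
rewrite -block_rankE in e1.
case: eqP => kr; last first.
  rewrite -val_eqE /= -[parent _ _ : nat]e1 b3 ?padE //; last by move/val_inj.
  rewrite -block_rankE; apply/eqP.
  by congr (_ + _)%N; exact: (@nparE (Tagged RT (ltree (bs j))) k).
have := b4 j (ltn_ord j); rewrite padE -[nroot _]/(nat_of_ord (root (ltree (bs j)))).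
rewrite -kr e1 (@nparE (Tagged RT u) j) offsetS padE => /andP[h1 h2].
have h : (parent w.1 (block_rank (mkvtx k)) - offset (pad 0 l) (parent u j)
    < tag (bs (parent u j)))%N.
  by rewrite ltn_subLR.
apply/existsP; exists (mkvtx (Ordinal h)); rewrite eqxx /= -val_eqE /= -block_rankE /=.
by rewrite subnKC.
Qed.

Let composite_composes (w : word X (width b)) : composite u block_rank w ->
  composes (Tagged RT u) (pad 0 l) (Tagged RT w.1) /\
  w.2 = [ffun k => letter (bs (tagnat.sig1 k)) (tagnat.sig2 k)].
Proof.
case/and4P=> _ _ /eqP h1 /forallP h2; split; last first.
  apply/ffunP=> k; rewrite ffunE; have /andP[/eqP <- _] := h2 (tagnat.sig k).
  by rewrite ffunE tagnat.sigK.
split.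
- by rewrite [LHS]widthE.
- by rewrite (padE (root u)); rewrite [LHS](congr1 (@nat_of_ord _) h1) -block_rankE.
- move=> j k ju; rewrite -[j]/(val (Ordinal ju)) padE => kj.
  have := h2 (@mkvtx _ _ bs (Ordinal ju) (Ordinal kj)) => /andP[_] /=.
  case: eqP => [e _ []|_ /eqP h _]; first by rewrite -[k]/(nat_of_ord (Ordinal kj)) e.
  have -> : (offset (pad 0 l) j + k)%N = block_rank (mkvtx (Ordinal kj)) :> nat.
    exact: (@block_rankE (Ordinal ju) (Ordinal kj)).
  rewrite (@nparE (Tagged RT w.1)) h -block_rankE; congr (_ + _)%N.
  exact: esym (@nparE (Tagged RT (ltree (bs (Ordinal ju)))) (Ordinal kj)).
move=> j ju; rewrite -[j]/(val (Ordinal ju)) padE.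
have := h2 (@mkvtx _ _ bs (Ordinal ju) (root (ltree (bs (Ordinal ju))))) => /andP[_] /=.
rewrite eqxx => /existsP[[j' k] /= /andP[/eqP e1 /eqP e2]].
rewrite -[nroot _]/(nat_of_ord (root (ltree (bs (Ordinal ju))))).
rewrite (@block_rankE (Ordinal ju)) (@nparE (Tagged RT w.1)) e2.
rewrite (@nparE (Tagged RT u) (Ordinal ju)) -e1.
by rewrite -[existT _ _ _]/(mkvtx k) -block_rankE padE leq_addr ltn_add2l ltn_ord.
Qed.

(** This translates the description by natural numbers into one by vertices,
    which is visibly equivariant. *)
Lemma mcoeff_comp_lab (K : comPzRingType) (w : word X (width b)) :
  (comp_lab K b)@_(Tagged (word X) w) = (composite u block_rank w)%:R.
Proof.
rewrite /comp_lab raddf_sum /= (bigD1 w.1) //= big1 ?addr0; last first.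
  move=> t tw; rewrite mcoeffU; case: eqP => // /eqP.
  by rewrite /mklab eq_Tagged /= => /eqP e; rewrite -e eqxx in tw.
rewrite mcoeffU /operad_comp -/l mcoeff_comp_from; last first.
  by rewrite size_map size_enum_ord.
rewrite -mulrnA mulnb; congr (_ *+ nat_of_bool _); rewrite /mklab eq_Tagged /=.
apply/andP/idP => [[/asboolP h1 /eqP h2]|/composite_composes[h1 h2]].
  by apply: composes_composite => //; rewrite -h2.
by split; [exact/asboolP | case: w h1 h2 => w1 w2 /= _ ->].
Qed.

Lemma mcoeff_comp_lab0 (K : comPzRingType) (a : lab X) :
  tag a <> width b -> (comp_lab K b)@_a = 0.
Proof.
move=> h; rewrite /comp_lab raddf_sum /= big1 // => t _; rewrite mcoeffU.
by case: eqP => // e; case: h; rewrite -e.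
Qed.

End CompLab.

Section Count.
Variables (Y : choiceType) (r : nat).

Definition num_composites (u : RT r) (bs : 'I_r -> lab Y) (a : lab Y) : nat :=
  #|[pred phi : {ffun vtx bs -> 'I_(tag a)} | composite u phi (tagged a)]|.

Lemma vtx_eq (bs : 'I_r -> lab Y) (x y : vtx bs) :
  tag x = tag y -> tagged x = tagged y :> nat -> x = y.
Proof.
case: x y => j k [j' k'] /= e; case: j' / e k' => k' /val_inj ->; reflexivity.
Qed.

Lemma composite_act (u : RT r) (bs : 'I_r -> lab Y) M (phi : {ffun vtx bs -> 'I_M})
    (w : word Y M) (s : 'S_M) :
  composite u phi (word_act s w) = composite u [ffun x => s^-1%g (phi x)] w.
Proof.
rewrite /composite; congr [&& _, _, _ & _].
- apply/injectiveP/injectiveP=> h x y; first by rewrite !ffunE => /perm_inj /h.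
  by move=> e; apply: h; rewrite !ffunE e.
- rewrite ffunE -[RHS](inj_eq (@perm_inj _ s)) permKV.
  by rewrite /root /=.
apply: eq_forallb => x; rewrite /vertex_ok; congr (_ && _); first by rewrite !ffunE.
case: ifP => _; last by rewrite !ffunE -[LHS](inj_eq (@perm_inj _ s^-1%g)) permK.
apply: eq_existsb => y; congr (_ && _).
by rewrite !ffunE -[LHS](inj_eq (@perm_inj _ s^-1%g)) permK.
Qed.

End Count.

(** Every bijection of the vertices of the composite is the standard numbering
    followed by a permutation. *)
Lemma card_composite (Y : choiceType) (b : lab (lab Y)) (w : word Y (width b))
    (P : pred {ffun vtx (letter b) -> 'I_(width b)}) :
  #|[pred phi | composite (ltree b) phi w && P phi]| =
  #|[pred g : 'S_(width b) | composite (ltree b) [ffun x => g (block_rank b x)] w &&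
      P [ffun x => g (block_rank b x)]]|.
Proof.
pose h (s : 'S_(width b)) : {ffun vtx (letter b) -> 'I_(width b)} :=
  [ffun x => s (block_rank b x)].
have h_inj : injective h.
  move=> s s' e; apply/permP=> k; have := congr1 (fun f : {ffun _} => f (tagnat.sig k)) e.
  by rewrite !ffunE tagnat.sigK.
rewrite -[RHS](card_imset _ h_inj); apply: eq_card => phi.
apply/idP/imsetP => [hphi|[s hs ->] //].
have [/and4P[phi_inj _ _ _] _] := andP hphi.
have s_inj : injective (fun k => phi (tagnat.sig k)).
  by move=> k k' /(injectiveP _ phi_inj)/tagnat.sig_inj.
have e : phi = h (perm s_inj).
  by apply/ffunP=> x; rewrite !ffunE permE tagnat.rankK.
by exists (perm s_inj) => //; rewrite unfold_in -/(h _) -e.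
Qed.

Lemma composite_width (Y : choiceType) (b : lab (lab Y)) M
    (phi : {ffun vtx (letter b) -> 'I_M}) (w : word Y M) :
  composite (ltree b) phi w -> M = width b.
Proof. by case/and4P=> _ + _ _; rewrite card_vtx => /eqP. Qed.

(** * Orbits and stabilizers *)

Section ActLemmas.
Variable X : choiceType.
Implicit Types a c d : lab X.

Lemma actE n (w : word X n) (s : 'S_n) :
  act (a := Tagged (word X) w) s = Tagged (word X) (word_act s w).
Proof. by []. Qed.

Lemma word_actV n (w w' : word X n) (s : 'S_n) :
  (word_act s w == w') = (w == word_act s^-1 w').
Proof.
apply/eqP/eqP=> [<-|->]; first by rewrite -word_actM mulgV word_act1.
by rewrite -word_actM mulVg word_act1.
Qed.

Lemma group_set_stab c : group_set (stab c).
Proof.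
apply/group_setP; split=> [|s s']; first by rewrite inE act1.
by rewrite !mem_stab word_actM => /eqP -> /eqP ->.
Qed.

(** The elements taking c to d form a coset of the stabilizer or the empty
    set. *)
Lemma card_act c d : #|[set s | act (a := c) s == d]| = (same_orbit c d * #|stab c|)%N.
Proof.
have [/existsP[s /eqP <-]|ns] := boolP (same_orbit c d); last first.
  apply/eqP; rewrite cards_eq0 -subset0; apply/subsetP=> s; rewrite inE => hs.
  by case/existsP: ns; exists s.
rewrite mul1n -[RHS](card_rcoset _ s); apply: eq_card => s'.
rewrite mem_rcoset !inE; case: c s s' => n w s s' /=.
by rewrite !actE !eq_Tagged /= word_actM [in RHS]word_actV invgK.
Qed.

Lemma sum_act (K : comPzRingType) c d :
  \sum_(s : 'S_(tag c)) (act s == d)%:R = (same_orbit c d * #|stab c|)%:R :> K.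
Proof.
rewrite -card_act -sum1_card natr_sum big_mkcond [RHS]big_mkcond /=.
by apply: eq_bigr => s _; rewrite inE; case: eqP.
Qed.

Lemma same_orbit_sym c d : same_orbit c d = same_orbit d c.
Proof. exact: (equiv_sym (same_orbit_equiv X)). Qed.

Lemma clsE c d : (cls c == cls d) = same_orbit c d.
Proof. exact: eqmodE. Qed.

Lemma clsP c d : reflect (cls c = cls d) (same_orbit c d).
Proof. by rewrite -clsE; apply: eqP. Qed.

Lemma repK : cancel (@rep X) (@cls X).
Proof. by move=> t; apply: reprK. Qed.

Lemma cls_act c s : cls (act (a := c) s) = cls c.
Proof. by apply/esym/clsP/existsP; exists s. Qed.

Lemma same_orbit_rep t d : same_orbit (rep t) d = (cls d == t).
Proof. by rewrite -clsE repK eq_sym. Qed.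

Section Trace.
Variable K : comPzRingType.

Lemma mcoeff_traceE (f : {malg K[lab X]}) a :
  (trace f)@_a = \sum_(c <- msupp f) f@_c * (same_orbit c a * #|stab c|)%:R.
Proof.
rewrite /trace mcoeff_linext; apply: eq_bigr => c _; congr (_ * _).
by rewrite mcoeff_sum -sum_act; apply: eq_bigr => s _; rewrite mcoeffU.
Qed.

Lemma card_stab_act c s : #|stab (act (a := c) s)| = #|stab c|.
Proof.
transitivity #|[set s' | act (a := c) s' == act (a := c) s]|; last first.
  have h : same_orbit c (act (a := c) s) by apply/existsP; exists s.
  by apply: etrans (card_act c (act (a := c) s)) _; rewrite h mul1n.
rewrite -[RHS](card_lcoset _ s^-1); apply: eq_card => s'.
by rewrite mem_lcoset invgK !inE actM.
Qed.

Lemma card_stab_orbit c d : same_orbit c d -> #|stab c| = #|stab d|.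
Proof. by case/existsP=> s /eqP <-; exact: esym (card_stab_act _). Qed.

Lemma mcoeff_trace (f : {malg K[lab X]}) a :
  (trace f)@_a = \sum_(s : 'S_(tag a)) f@_(act (a := a) s).
Proof.
rewrite mcoeff_traceE.
under [RHS]eq_bigr => s _ do rewrite mcoeff_sum_msupp.
rewrite exchange_big /=; apply: eq_bigr => c _; rewrite -mulr_sumr; congr (_ * _).
under eq_bigr => s _ do rewrite eq_sym.
rewrite sum_act same_orbit_sym.
by have [h|] := boolP (same_orbit a c); rewrite ?mul0n // (card_stab_orbit h).
Qed.

End Trace.
End ActLemmas.

Section OrbitSum.
Variables (K : comPzRingType) (X : choiceType).
Implicit Types c a : lab X.

Lemma act_repr c (x : 'S_(tag c)) :
  act (a := c) (fingroup.repr (stab c :* x)%g) = act (a := c) x.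
Proof.
have xC : x \in (stab c :* x)%g.
  by apply/rcosetP; exists 1%g; rewrite ?mul1g // inE act1.
by case/rcosetP: (mem_repr x xC) => h hs ->; rewrite act_stab.
Qed.

(** Different cosets of the stabilizer give different elements of the orbit. *)
Lemma mcoeff_orbit_sum c a : (orbit_sum K c)@_a = (same_orbit c a)%:R.
Proof.
pose G := Group (group_set_stab c).
rewrite /orbit_sum mcoeff_sum.
have [/existsP[s /eqP es]|ns] := boolP (same_orbit c a); last first.
  rewrite big1 // => C /rcosetsP[x _ ->]; rewrite mcoeffU act_repr.
  by case: eqP => // e; case/existsP: ns; exists x; apply/eqP.
transitivity (\sum_(C in rcosets (stab c) [set: 'S_(tag c)])
    (C == stab c :* s)%g%:R : K).
  apply: eq_bigr => C /rcosetsP[x _ ->]; rewrite mcoeffU act_repr.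
  congr (_ *+ nat_of_bool _); apply/eqP/eqP => [|e]; last first.
    by rewrite -(act_repr x) e act_repr.
  move=> e; apply: (@rcoset_eqP _ G); rewrite mem_rcoset; apply: (etrans (mem_stab _)).
  move: e; rewrite -es; case: (c) s x {es} => n w s x /eqP.
  rewrite !actE eq_Tagged /= word_actM => /eqP ->.
  by rewrite -word_actM mulgV word_act1 eqxx.
rewrite (bigD1 (stab c :* s)%g) /=; last by apply/rcosetsP; exists s; rewrite ?inE.
by rewrite eqxx big1 ?addr0 // => C /andP[_ /negPf ->].
Qed.

Lemma mcoeff_orb t a : (gamma_val (orb K t))@_a = (cls a == t)%:R :> K.
Proof. by rewrite mcoeff_orbit_sum same_orbit_rep. Qed.

End OrbitSum.

(** * The trace of a composite *)

Section TraceComp.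
Variables (K : comPzRingType) (Y : choiceType).

(** A relabelling of a composite for the standard numbering is a composite for
    another numbering, so the trace counts numberings. *)
Lemma mcoeff_trace_comp (b : lab (lab Y)) a :
  (trace (comp_lab K b))@_a = (num_composites (ltree b) (letter b) a)%:R.
Proof.
rewrite mcoeff_trace; have [e|ne] := eqVneq (tag a) (width b); last first.
  rewrite big1 => [|s _]; last by rewrite mcoeff_comp_lab0 //; apply/eqP.
  rewrite /num_composites eq_card0 // => phi; rewrite inE; apply/negP=> /and4P[_ + _ _].
  by rewrite card_vtx eq_sym (negPf ne).
case: a e => m w /= e; subst m.
under eq_bigr => s _ do rewrite mcoeff_comp_lab composite_act.
rewrite /num_composites /= -natr_sum; congr _%:R.
rewrite (reindex_inj invg_inj) /=.
under eq_bigr => s _ do rewrite invgK.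
transitivity #|[pred phi : {ffun vtx (letter b) -> 'I_(width b)} |
                  composite (ltree b) phi w && predT phi]|; last first.
  by apply: eq_card => phi; rewrite !inE andbT.
rewrite card_composite -sum1_card [RHS]big_mkcond; apply: eq_bigr => s _.
by rewrite inE andbT; case: (composite _ _ _).
Qed.

End TraceComp.

Section Move.
Variables (Y : choiceType) (r : nat) (bs : 'I_r -> lab Y) (s : 'S_r).

(** Permuting the members of the family permutes the blocks. *)
Definition move_vtx (x : vtx (fun j => bs (s j))) : vtx bs :=
  @mkvtx _ _ bs (s (tag x)) (tagged x).

Lemma move_vtx_subproof (y : vtx bs) : tag (bs (tag y)) = tag (bs (s (s^-1%g (tag y)))).
Proof. by rewrite permKV. Qed.

Definition unmove_vtx (y : vtx bs) : vtx (fun j => bs (s j)) :=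
  @mkvtx _ _ (fun j => bs (s j)) (s^-1%g (tag y)) (cast_ord (move_vtx_subproof y) (tagged y)).

Lemma move_vtxK : cancel move_vtx unmove_vtx.
Proof. by move=> x; apply: vtx_eq; rewrite //= permK. Qed.

Lemma unmove_vtxK : cancel unmove_vtx move_vtx.
Proof. by move=> x; apply: vtx_eq; rewrite //= permKV. Qed.

Lemma card_vtx_move : #|vtx (fun j => bs (s j))| = #|vtx bs|.
Proof.
apply: (@bij_eq_card _ _ move_vtx).
by exists unmove_vtx; [exact: move_vtxK | exact: unmove_vtxK].
Qed.

End Move.

Section CountMove.
Variables (Y : choiceType) (r : nat).

Lemma vertex_ok_move (u : RT r) (bs : 'I_r -> lab Y) (s : 'S_r) M
    (phi : {ffun vtx bs -> 'I_M}) (w : word Y M) x :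
  vertex_ok (relabel s^-1 u) [ffun x => phi (@move_vtx _ _ bs s x)] w x =
  vertex_ok u phi w (@move_vtx _ _ bs s x).
Proof.
rewrite /vertex_ok !ffunE /=; congr (_ && _).
case: ifP => _; last by rewrite ?ffunE.
apply/existsP/existsP => -[y]; rewrite ?ffunE => /andP[/eqP h1 h2].
  exists (move_vtx y); rewrite h2 andbT /= h1.
  by rewrite ?ffunE ?invgK permKV.
exists (@unmove_vtx _ _ bs s y); rewrite ffunE unmove_vtxK h2 andbT /= h1.
by rewrite ?ffunE ?invgK.
Qed.

Lemma composite_move (u : RT r) (bs : 'I_r -> lab Y) (s : 'S_r) M
    (phi : {ffun vtx bs -> 'I_M}) (w : word Y M) :
  composite (relabel s^-1 u) [ffun x => phi (@move_vtx _ _ bs s x)] w = composite u phi w.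
Proof.
have K1 := @unmove_vtxK _ _ bs s.
rewrite /composite; congr [&& _, _, _ & _].
- apply/injectiveP/injectiveP=> h x y.
    rewrite -(K1 x) -(K1 y) => e; congr (move_vtx _).
    by apply: h; rewrite !ffunE.
  by rewrite !ffunE => /h /(can_inj (@move_vtxK _ _ bs s)).
- by rewrite card_vtx_move.
- congr (_ == _); rewrite ffunE; congr (phi _).
  by apply: vtx_eq; rewrite //= /root /= permKV.
apply/forallP/forallP=> h x; last by rewrite vertex_ok_move.
by rewrite -(K1 x) -vertex_ok_move.
Qed.

(** Equivariance of the operadic composition under the symmetric group of the
    outer tree, in the form of a bijection between numberings. *)
Lemma num_composites_move (u : RT r) (bs : 'I_r -> lab Y) (s : 'S_r) a :
  num_composites (relabel s^-1 u) (fun j => bs (s j)) a = num_composites u bs a.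
Proof.
pose h (phi : {ffun vtx bs -> 'I_(tag a)}) := [ffun x => phi (@move_vtx _ _ bs s x)].
have h_inj : injective h.
  move=> phi phi' e; apply/ffunP=> x; rewrite -(@unmove_vtxK _ _ bs s x).
  by have := congr1 (fun f : {ffun _} => f (@unmove_vtx _ _ bs s x)) e; rewrite !ffunE.
rewrite /num_composites -[RHS](card_imset _ h_inj); apply: eq_card => phi.
apply/idP/imsetP => [hphi|[psi hpsi ->]]; last by rewrite unfold_in composite_move.
have e : phi = h [ffun x => phi (@unmove_vtx _ _ bs s x)].
  by apply/ffunP=> x; rewrite !ffunE move_vtxK.
exists [ffun x => phi (@unmove_vtx _ _ bs s x)] => //.
by rewrite unfold_in -(composite_move _ s) -/(h _) -e.
Qed.

End CountMove.

Lemma num_composites_act (Y : choiceType) (b : lab (lab Y)) (s : 'S_(tag b)) a :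
  num_composites (ltree (act (a := b) s)) (letter (act (a := b) s)) a =
  num_composites (ltree b) (letter b) a.
Proof.
rewrite -[RHS](num_composites_move _ _ s^-1) invgK; congr num_composites.
by apply/funext=> j; rewrite ffunE.
Qed.

Section Stamp.
Variables (K : comPzRingType) (X : choiceType).

(** With the position of each vertex written next to its letter, the letters of
    a become distinct: a relabelling taking a given element to stamp a is
    determined by the letters, as it is in unplace. *)
Definition stamp (a : lab X) : lab (nat * X)%type :=
  mklab (ltree a) [ffun k => (val k, letter a k)].

Lemma act_stampP (d : lab (nat * X)%type) (a : lab X) s :
  act (a := d) s = stamp a -> forall k, val (s k) = (letter d k).1.
Proof.
case: d s => n w s; case: a => m v; rewrite actE /stamp /mklab => e k.
have nm : n = m := congr1 tag e; subst m.
have /eqP := e; rewrite eq_Tagged /= => /eqP /(congr1 snd)/ffunP/(_ (s k)).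
by rewrite /= !ffunE permK /letter /= => ->.
Qed.

Lemma act_stampE (d : lab (nat * X)%type) (a : lab X) (s : 'S_(tag d)) :
  (forall k, val (s k) = (letter d k).1) ->
  (act (a := d) s == stamp a) =
  (act (a := mklab (ltree d) [ffun k => (letter d k).2]) s == a).
Proof.
case: d s => n w s; case: a => m v /= h.
rewrite actE /stamp /mklab.
have [e|nm] := eqVneq n m; last first.
  by apply/eqP/eqP=> /(congr1 tag) /= /eqP; rewrite (negPf nm).
subst m; rewrite actE !eq_Tagged /= /word_act /=.
rewrite /ltree /letter /= -!pair_eqE /pair_eq /=; congr (_ && _).
apply/eqP/eqP => /ffunP e; apply/ffunP=> k; have := e k; rewrite !ffunE.
  by move=> ->.
by move=> <-; rewrite -[k in val k](permKV s) [val _]h -surjective_pairing.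
Qed.

Lemma mcoeff_unplace (d : lab (nat * X)%type) (a : lab X) :
  (unplace K d)@_a = \sum_(s : 'S_(tag d)) (act s == stamp a)%:R.
Proof.
rewrite /unplace; case: pickP => [g /forallP hg|none]; last first.
  rewrite mcoeff0 big1 // => s _; case: eqP => // /act_stampP h.
  by have /forallP[] := negbT (none s); move=> k; apply/eqP/h.
have {}hg k : val (g k) = (letter d k).1 by apply/eqP.
rewrite mcoeffU (bigD1 g) //= act_stampE // big1 ?addr0 // => s sg.
case: eqP => // /act_stampP h; case/eqP: sg.
by apply/permP=> k; apply: val_inj; rewrite h hg.
Qed.

(** The prescribed positions select one relabelling among those over which the
    trace sums, so the composite of a placed element is a trace evaluated at
    stamped words. *)
Lemma mcoeff_comp_placed (c : lab (lab (nat * X)%type)) a :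
  (comp_placed K c)@_a = (num_composites (ltree c) (letter c) (stamp a))%:R.
Proof.
rewrite -mcoeff_trace_comp /comp_placed /trace !mcoeff_linext.
apply: eq_bigr => d _; congr (_ * _); rewrite mcoeff_unplace mcoeff_sum.
by apply: eq_bigr => s _; rewrite mcoeffU.
Qed.

Lemma comp_placed_act c s :
  comp_placed K (act (a := c) s) = comp_placed K c :> {malg K[lab X]}.
Proof. by apply/malgP=> a; rewrite !mcoeff_comp_placed num_composites_act. Qed.

End Stamp.

Lemma mklab_eta (Y : choiceType) (a : lab Y) (x : {ffun 'I_(tag a) -> Y}) :
  (forall k, x k = letter a k) -> mklab (ltree a) x = a.
Proof.
by case: a x => n [t w] x h; rewrite (_ : x = w) //; apply/ffunP.
Qed.

(** * Placed elements *)

Section Placed.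
Variable X : choiceType.
Notation PX := (nat * X)%type.

Section Fun.
Variables (r : nat).

Definition pos (bs : 'I_r -> lab PX) (x : vtx bs) : nat :=
  (letter (bs (tag x)) (tagged x)).1.

(** An intrinsic form of placed, from which the invariance under the symmetric
    group of the outer tree is clear: the positions run through an initial
    segment of the natural numbers and increase on every block. *)
Definition well_placed (bs : 'I_r -> lab PX) : Prop :=
  [/\ injective (@pos bs), forall x : vtx bs, (pos x < #|vtx bs|)%N &
      forall j (k l : 'I_(tag (bs j))), (k < l)%N ->
        (pos (@mkvtx _ _ bs j k) < pos (@mkvtx _ _ bs j l))%N].

Lemma well_placed_move (bs : 'I_r -> lab PX) (s : 'S_r) :
  well_placed bs -> well_placed (fun j => bs (s j)).
Proof.
case=> h1 h2 h3; split.
- by move=> x y e; apply: (can_inj (@move_vtxK _ _ bs s)); apply: h1.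
- by move=> x; rewrite card_vtx_move; apply: (h2 (@move_vtx _ _ bs s x)).
by move=> j k l; apply: h3.
Qed.

Definition place1 (a : lab X) (p : 'I_(tag a) -> nat) : lab PX :=
  mklab (ltree a) [ffun k => (p k, letter a k)].

Definition forget1 (a : lab PX) : lab X := mklab (ltree a) [ffun k => (letter a k).2].

Lemma place1K a p : forget1 (place1 (a := a) p) = a.
Proof.
by apply: mklab_eta => k; rewrite !ffunE.
Qed.

End Fun.

Definition forget (c : lab (lab PX)) : lab (lab X) :=
  mklab (ltree c) [ffun j => forget1 (letter c j)].

Lemma letter_place (b : lab (lab X)) (g : 'S_(width b)) :
  letter (place g) =
    (fun j => place1 (a := letter b j) (fun k => val (g (tagnat.Rank j k))))
  :> ('I_(tag b) -> lab PX).
Proof. by apply/funext=> j; rewrite ffunE. Qed.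

Lemma forget_place (b : lab (lab X)) (g : 'S_(width b)) : forget (place g) = b.
Proof.
by apply: mklab_eta => j; rewrite ffunE letter_place place1K.
Qed.

Lemma place_inj (b : lab (lab X)) : injective (@place X b).
Proof.
move=> g g' e; apply/permP=> y; apply: val_inj.
have /eqP := e; rewrite eq_Tagged /= => /eqP /(congr1 snd)/ffunP/(_ (tagnat.sig1 y)).
rewrite !ffunE => /eqP; rewrite eq_Tagged /= => /eqP /(congr1 snd)/ffunP/(_ (tagnat.sig2 y)).
by rewrite !ffunE => -[]; rewrite tagnat.sig2K.
Qed.

Lemma placed_well_placed (c : lab (lab PX)) : placed c -> well_placed (letter c).
Proof.
case=> b [g gs ->]; rewrite letter_place; split.
- move=> [j k] [j' k']; rewrite /pos /letter /= !ffunE => /val_inj/perm_inj.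
  exact: tagnat.rank_inj.
- move=> x; rewrite /pos /letter /= ffunE.
  have -> : #|vtx (fun j => place1 (a := letter b j)
      (fun k => val (g (tagnat.Rank j k))))| = width b.
    exact: card_vtx.
  exact: ltn_ord.
move=> j k l kl; rewrite /pos /letter /= !ffunE /=.
move/forallP: gs => /(_ (tagnat.Rank j k))/forallP/(_ (tagnat.Rank j l)).
rewrite !tagnat.Rank1K eqxx /= => /implyP; apply.
by have := @tagnat.lt_Rank _ (fun j => tag (letter b j)) j k l; rewrite !ltEord => ->.
Qed.

End Placed.

Section Placed2.
Variables (K : comPzRingType) (X : choiceType).
Notation PX := (nat * X)%type.
Implicit Types c d p : lab (lab PX).

Lemma place1_forget (d : lab PX) :
  d = place1 (a := forget1 d) (fun k => (letter d k).1).
Proof.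
by apply/esym/(@mklab_eta _ d) => k; rewrite !ffunE -surjective_pairing.
Qed.

Lemma well_placed_placed c : well_placed (letter c) -> placed c.
Proof.
pose b := forget c; pose r := tag c.
have hp (j : 'I_r) : exists q, letter c j = place1 (a := letter b j) q.
  by rewrite ffunE; exists (fun k => (letter (letter c j) k).1); apply: place1_forget.
(* Choosing the positions q j makes the blocks of c convertible to those of b,
   apart from the positions written next to their letters. *)
pose q j := sval (cid (hp j)).
have ec : letter c = (fun j => place1 (q j)) :> ('I_r -> _).
  by apply/funext=> j; apply: svalP (cid (hp j)).
rewrite ec => -[h1 h2 h3].
have posE (x : vtx (fun j => place1 (q j))) : pos x = q (tag x) (tagged x).
  by rewrite /pos /letter /= ffunE.
have lt (y : 'I_(width b)) : (pos (tagnat.sig y : vtx (fun j => place1 (q j))) < width b)%N.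
  by apply: leq_trans (h2 _) _; rewrite (eq_leq (card_vtx b)).
have G_inj : injective (fun y => Ordinal (lt y)).
  by move=> y y' /(congr1 val)/h1/tagnat.sig_inj.
exists b, (perm G_inj).
  apply/forallP=> y; apply/forallP=> z; apply/implyP; rewrite !permE /= !posE.
  rewrite -{1 2}(tagnat.sigK y) -{1 2}(tagnat.sigK z).
  case: (tagnat.sig y) => j k; case: (tagnat.sig z) => j' l.
  rewrite /tagnat.sig1 !tagnat.rankK /=; case: eqP => //= e; subst j'.
  have := @tagnat.lt_Rank _ (fun j => tag (letter b j)) j k l.
  by rewrite !ltEord => -> /h3; rewrite !posE.
apply/esym/(@mklab_eta _ c) => j; rewrite ffunE ec; congr (mklab _ _).
by apply/ffunP=> k; rewrite !ffunE permE /= posE tagnat.rankK [RHS]ffunE.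
Qed.

Lemma placedP c : placed c <-> well_placed (letter c).
Proof. by split; [apply: placed_well_placed | apply: well_placed_placed]. Qed.

Lemma placed_act c s : placed c -> placed (act (a := c) s).
Proof.
move/placedP/(@well_placed_move _ _ _ (s^-1)%g) => h; apply/placedP.
suff -> : letter (act (a := c) s) = (fun j => letter c (s^-1%g j)) :> (_ -> _) by [].
by apply/funext=> j; rewrite ffunE.
Qed.

Lemma placed_orbit c d : same_orbit c d -> placed c -> placed d.
Proof. by case/existsP=> s /eqP <-; apply: placed_act. Qed.

(** The action is free because the positions written in different blocks are
    different, and no block is empty. *)
Lemma stab_placed c : placed c -> #|stab c| = 1%N.
Proof.
move/placedP=> [h _ _]; apply/eqP/cards1P; exists 1%g; apply/setP=> s.
apply/idP/set1P => [|->]; last by rewrite inE act1.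
move=> hs; apply/permP=> j; rewrite perm1; move: hs; rewrite mem_stab.
move/eqP/(congr1 snd)/ffunP/(_ (s j)); rewrite ffunE permK => ej.
(* The position written at the root of a block distinguishes the blocks. *)
pose R (a : lab PX) := (letter a (root (ltree a))).1.
have e : pos (@mkvtx _ _ (letter c) j (root (ltree (letter c j)))) =
         pos (@mkvtx _ _ (letter c) (s j) (root (ltree (letter c (s j))))).
  by rewrite -[LHS]/(R (letter c j)) -[RHS]/(R (letter c (s j))); congr R.
by have /(congr1 tag) /= <- := h _ _ e.
Qed.

Lemma mcoeff_induce (b : lab (lab X)) p :
  (induce K b)@_p = (`[< placed p >] && (forget p == b))%:R.
Proof.
rewrite /induce mcoeff_sum; case: asboolP => [[b' [g gs ->]]|np] /=; last first.
  rewrite big1 // => g gs; rewrite mcoeffU; case: eqP => // e; case: np.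
  by exists b, g.
rewrite forget_place; case: eqP => [e|ne]; last first.
  rewrite big1 // => g' _; rewrite mcoeffU; case: eqP => // /(congr1 (@forget X)).
  by rewrite !forget_place => e; case: ne.
subst b'; transitivity (\sum_(g' : 'S_(width b) | shuffle g') (g' == g)%:R : K).
  apply: eq_bigr => g' _; rewrite mcoeffU; congr (_ *+ nat_of_bool _).
  exact: inj_eq (@place_inj X b) _ _.
by rewrite (bigD1 g) //= eqxx big1 ?addr0 // => g' /andP[_ /negPf ->].
Qed.

(** The composition is constant on orbits, hence factors through the linear map
    to the free module on the orbits.  On placed elements this map is the trace
    evaluated at representatives, as the stabilizers are trivial. *)
(** The composite of a preimage under the trace depends only on the trace. *)
Lemma comp_placed_trace_ker (f : {malg K[lab (lab PX)]}) :
  (forall c, c \in msupp f -> placed c) -> trace f = 0 -> linext (@comp_placed K X) f = 0.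
Proof.
move=> fp tr0.
transitivity (linext (fun e => comp_placed K (rep e)) (linext (fun c => << cls c >>) f)).
  rewrite linext_comp; apply: eq_linext => c _; rewrite linextU.
  have : same_orbit (rep (cls c)) c by rewrite same_orbit_rep.
  by case/existsP=> s /eqP e; rewrite -[in LHS]e comp_placed_act.
suff -> : linext (fun c => << cls c >>) f = 0 by rewrite linext0.
apply/malgP=> e; transitivity ((trace f)@_(rep e)); last by rewrite tr0 !mcoeff0.
rewrite mcoeff_traceE mcoeff_linext.
rewrite [LHS]big_seq [RHS]big_seq; apply: eq_bigr => c /fp cp; congr (_ * _).
by rewrite mcoeffU same_orbit_sym same_orbit_rep (stab_placed cp) muln1.
Qed.

Lemma comp_placed_trace (f g : {malg K[lab (lab PX)]}) :
  (forall c, c \in msupp f -> placed c) -> (forall c, c \in msupp g -> placed c) ->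
  trace f = trace g -> linext (@comp_placed K X) f = linext (@comp_placed K X) g.
Proof.
move=> fp gp e; apply/eqP; rewrite -subr_eq0 -linextB; apply/eqP.
apply: comp_placed_trace_ker; last by rewrite /trace linextB -!/(trace _) e subrr.
move=> c /(fsubsetP (msuppB_le f g)); rewrite inE => /orP[/fp|/gp] //.
Qed.

(** Since the action is free, an invariant element is the trace of its
    restriction to a set of orbit representatives. *)
Lemma trace_preimage (y : {malg K[lab (lab PX)]}) :
  (forall c, c \in msupp y -> placed c) -> (forall c s, y@_(act (a := c) s) = y@_c) ->
  exists2 z, forall c, c \in msupp z -> placed c & trace z = y.
Proof.
move=> yp yi; pose z := \sum_(c <- msupp y) << y@_c *+ (rep (cls c) == c) *g c >>.
have zE c : z@_c = y@_c *+ (rep (cls c) == c).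
  rewrite mcoeff_sum [in RHS]mcoeff_sum_msupp -sumrMnl; apply: eq_bigr => d _.
  by rewrite mcoeffU mulr_natr; case: (eqVneq d c) => [->|]; rewrite // !mulr0n mul0rn.
exists z => [c|].
  rewrite -mcoeff_neq0 zE => h; apply: yp; rewrite -mcoeff_neq0.
  by apply: contraNneq h => ->; rewrite mul0rn.
apply/malgP=> d; rewrite mcoeff_trace.
under eq_bigr => s _ do rewrite zE cls_act yi eq_sym -mulr_natr.
rewrite -mulr_sumr sum_act same_orbit_sym same_orbit_rep eqxx mul1n.
have [/yp dp|/mcoeff_outdom ->] := boolP (d \in msupp y); last by rewrite mul0r.
by rewrite (stab_placed dp) mulr1.
Qed.

End Placed2.

(** * The image of an orbit sum in placed elements *)

Section Expand.
Variables (K : comPzRingType) (X : choiceType).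

Definition mapcls (c : lab (lab X)) : lab (SRT X) :=
  mklab (ltree c) [ffun j => cls (letter c j)].

Lemma mapcls_act c s : mapcls (act (a := c) s) = act (a := mapcls c) s.
Proof.
apply: (@mklab_eta _ (act (a := mapcls c) s)) => j.
by rewrite /letter /= !ffunE.
Qed.

(** A tuple of words has coefficient one in the tensor product of the orbit sums
    exactly if its classes are the given ones. *)
Lemma mcoeff_expand (b : lab (SRT X)) c :
  (expand_orbits K b)@_c = (mapcls c == b)%:R.
Proof.
rewrite /expand_orbits; case: b c => n [t x] [m [t' a]].
have [e|ne] := eqVneq m n; last first.
  rewrite mcoeff_linext0.
    by case: eqP => // /(congr1 tag) /= e; case/eqP: ne.
  move=> d _; rewrite mcoeffU; case: eqP => // /(congr1 tag) /= e.
  by case/eqP: ne.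
subst m; rewrite (@mcoeff_linext1 _ _ _ _ _ _ a) => [|d _ da]; last first.
  rewrite mcoeffU /mklab eq_Tagged /= -pair_eqE /pair_eq /= andbC.
  by rewrite (negPf da).
rewrite mcoeff_tensor mcoeffU /mapcls /mklab !eq_Tagged /= -!pair_eqE /pair_eq /=.
rewrite eq_sym andbC; under eq_bigr do rewrite mcoeff_orb.
rewrite eqxx andTb mulr_natr.
have -> : \prod_(i < n) (cls (a i) == x i)%:R = ([ffun j => cls (a j)] == x)%:R :> K.
  case: eqP => [<-|ne]; first by rewrite big1 // => j _; rewrite ffunE eqxx.
  have [/forallP h|/forallPn[j hj]] := boolP [forall j, cls (a j) == x j].
    by case: ne; apply/ffunP=> j; rewrite ffunE; apply/eqP.
  by rewrite (bigD1 j) //= (negPf hj) mul0r.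
by case: eqP; case: eqP.
Qed.

Definition expand_induce (b : lab (SRT X)) : {malg K[lab (lab (nat * X)%type)]} :=
  linext (@induce K X) (expand_orbits K b).

Lemma mcoeff_expand_induce b p :
  (expand_induce b)@_p = (`[< placed p >] && (mapcls (forget p) == b))%:R.
Proof.
rewrite /expand_induce (@mcoeff_linext1 _ _ _ _ _ _ (forget p)) => [|a _ ne].
  by rewrite mcoeff_expand mcoeff_induce eqxx andbT -natrM mulnb andbC.
by rewrite mcoeff_induce eq_sym (negPf ne) andbF.
Qed.

Lemma forget_act (p : lab (lab (nat * X)%type)) s :
  forget (act (a := p) s) = act (a := forget p) s.
Proof.
apply: (@mklab_eta _ (act (a := forget p) s)) => j.
by rewrite /letter /= !ffunE.
Qed.

End Expand.

(** * Shuffles, and permutations inside the blocks *)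

(** Distributivity, for factors indexed by different types. *)
Lemma prod_sum_fprod (R : comPzRingType) (I : finType) (T : I -> finType)
    (P : forall i, T i -> R) :
  \prod_i \sum_(x : T i) P i x = \sum_(f : fprod T) \prod_i P i (f i).
Proof.
pose Q i : {ffun T i -> R} := [ffun x => P i x].
transitivity (\sum_(f : fprod T) \prod_i Q i (f i)); last first.
  by apply: eq_bigr => f _; apply: eq_bigr => i _; rewrite ffunE.
rewrite big_fprod -(bigA_distr_big_dep (fun i => tagged_with T i)
  (fun i x => untag 0 (Q i) x)).
apply: eq_bigr => i _; transitivity (\sum_(x : T i) Q i x); last first.
  exact: (big_tag (fun i x => Q i x) i).
by apply: eq_bigr => x _; rewrite ffunE.
Qed.

(** Every injective sequence is sorted by exactly one permutation: s k is the
    number of values below that of k. *)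
Lemma sort_perm n m (q : 'I_n -> 'I_m) : injective q ->
  exists s : 'S_n, forall s' : 'S_n,
    [forall k, forall l, (s' k < s' l)%N ==> (q k < q l)%N] = (s' == s).
Proof.
move=> q_inj; pose A k := [set l | (q l < q k)%N].
(* The permutation sought maps k to the cardinality of A k. *)
have A_lt k : (#|A k| < n)%N.
  rewrite -[X in (_ < X)%N]card_ord -cardsT; apply: proper_card.
  by apply/properP; split; [exact: subsetT | exists k; rewrite !inE ?ltnn].
have A_mono k l : (q k < q l)%N -> (#|A k| < #|A l|)%N.
  move=> kl; apply: proper_card; apply/properP; split.
    by apply/subsetP=> i; rewrite !inE => /ltn_trans; apply.
  by exists k; rewrite !inE ?ltnn.
have A_mono' k l : (#|A k| < #|A l|)%N -> (q k < q l)%N.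
  case: (ltngtP (q k) (q l)) => // [/A_mono h|/val_inj/q_inj ->]; last by rewrite ltnn.
  by move/(ltn_trans h); rewrite ltnn.
pose f k := Ordinal (A_lt k).
have f_inj : injective f.
  move=> k l /(congr1 val) /= e.
  case: (ltngtP (q k) (q l)) => [/A_mono|/A_mono|/val_inj/q_inj //]; by rewrite e ltnn.
exists (perm f_inj) => s'; apply/forallP/eqP => [h|-> k]; last first.
  by apply/forallP=> l; apply/implyP; rewrite !permE; apply: A_mono'.
have s'q k l : (s' k < s' l)%N = (q k < q l)%N.
  have H i j : (s' i < s' j)%N -> (q i < q j)%N.
    by have /forallP/(_ j)/implyP := h i.
  apply/idP/idP => [/H //|]; case: (ltngtP (s' k) (s' l)) => // [/H kl /(ltn_trans kl)|].
    by rewrite ltnn.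
  by move/val_inj/perm_inj => ->; rewrite ltnn.
apply/permP=> k; apply: val_inj; rewrite permE /=.
have -> : A k = s' @^-1: [set i : 'I_n | (i < s' k)%N].
  by apply/setP=> l; rewrite !inE s'q.
rewrite card_preimset; last exact: perm_inj.
by rewrite -sum1dep_card (big_ord_narrow (ltnW (ltn_ord (s' k)))) /= sum1_card card_ord.
Qed.

Section Blocks.
Variables (X : choiceType) (r : nat).

(** The numberings that come from shuffles. *)
Definition increasing (bs : 'I_r -> lab X) M (phi : {ffun vtx bs -> 'I_M}) : bool :=
  [forall j : 'I_r, forall k : 'I_(tag (bs j)), forall l : 'I_(tag (bs j)), (k < l)%N ==>
     (phi (@mkvtx _ _ bs j k) < phi (@mkvtx _ _ bs j l))%N].

Variables (bs : 'I_r -> lab X) (sg : forall j, 'S_(tag (bs j))).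

Definition act_all (j : 'I_r) : lab X := act (a := bs j) (sg j).

Definition act_vtx (x : vtx bs) : vtx act_all :=
  @mkvtx _ _ act_all (tag x) (sg (tag x) (tagged x)).

Definition unact_vtx (x : vtx act_all) : vtx bs :=
  @mkvtx _ _ bs (tag x) ((sg (tag x))^-1%g (tagged x)).

Definition sorted_by M (psi : {ffun vtx bs -> 'I_M}) : bool :=
  [forall j : 'I_r, forall k : 'I_(tag (bs j)), forall l : 'I_(tag (bs j)),
    (sg j k < sg j l)%N ==>
    (psi (@mkvtx _ _ bs j k) < psi (@mkvtx _ _ bs j l))%N].

Lemma act_vtxK : cancel act_vtx unact_vtx.
Proof. by move=> x; apply: vtx_eq; rewrite //= permK. Qed.

Lemma unact_vtxK : cancel unact_vtx act_vtx.
Proof. by move=> x; apply: vtx_eq; rewrite //= permKV. Qed.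

Lemma vertex_ok_act_vtx (u : RT r) M (phi : {ffun vtx act_all -> 'I_M}) (w : word X M) x :
  vertex_ok u [ffun x => phi (act_vtx x)] w x = vertex_ok u phi w (act_vtx x).
Proof.
rewrite /vertex_ok; congr (_ && _).
  by rewrite ffunE; congr (_ == _); rewrite /letter /= ffunE permK.
have -> : (tagged (act_vtx x) == root (ltree (act_all (tag (act_vtx x))))) =
          (tagged x == root (ltree (bs (tag x)))).
  exact: (inj_eq (@perm_inj _ (sg (tag x)))).
case: ifP => _; last first.
  rewrite !ffunE; congr (_ == phi _); apply: vtx_eq => //=.
  by rewrite ?ffunE permK.
apply/existsP/existsP => -[y]; rewrite ?ffunE => /andP[h1 h2].
  by exists (act_vtx y); rewrite h2 andbT /=.
by exists (unact_vtx y); rewrite ffunE unact_vtxK h2 andbT /=.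
Qed.

(** Equivariance of the operadic composition under permutations inside the
    blocks. *)
Lemma composite_act_vtx (u : RT r) M (phi : {ffun vtx act_all -> 'I_M}) (w : word X M) :
  composite u [ffun x => phi (act_vtx x)] w = composite u phi w.
Proof.
rewrite /composite; congr [&& _, _, _ & _].
- apply/injectiveP/injectiveP=> h x y.
    rewrite -(unact_vtxK x) -(unact_vtxK y) => e; congr (act_vtx _).
    by apply: h; rewrite !ffunE.
  by rewrite !ffunE => /h /(can_inj act_vtxK).
- by rewrite ffunE.
apply/forallP/forallP=> h x; last by rewrite vertex_ok_act_vtx.
by rewrite -(unact_vtxK x) -vertex_ok_act_vtx.
Qed.

Lemma increasing_act_vtx M (phi : {ffun vtx act_all -> 'I_M}) :
  increasing phi = sorted_by [ffun x => phi (act_vtx x)].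
Proof.
apply: eq_forallb => j; apply/forallP/forallP => h k; apply/forallP=> l.
  by have /forallP := h (sg j k); rewrite !ffunE; apply.
have /forallP/(_ ((sg j)^-1%g l)) := h ((sg j)^-1%g k).
rewrite !ffunE !permKV; set a := act_vtx _; set b := act_vtx _.
have -> : a = @mkvtx _ _ act_all j k by apply: vtx_eq; rewrite //= permKV.
by have -> : b = @mkvtx _ _ act_all j l by apply: vtx_eq; rewrite //= permKV.
Qed.

Lemma card_increasing_act_vtx (u : RT r) M (w : word X M) :
  #|[pred phi : {ffun vtx act_all -> 'I_M} | composite u phi w && increasing phi]| =
  #|[pred psi : {ffun vtx bs -> 'I_M} | composite u psi w && sorted_by psi]|.
Proof.
pose h (phi : {ffun vtx act_all -> 'I_M}) := [ffun x => phi (act_vtx x)].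
have h_inj : injective h.
  move=> phi phi' e; apply/ffunP=> x; rewrite -(unact_vtxK x).
  by have := congr1 (fun f : {ffun _} => f (unact_vtx x)) e; rewrite !ffunE.
have hP phi : composite u phi w && increasing phi =
    (composite u (h phi) w && sorted_by (h phi)).
  by rewrite composite_act_vtx increasing_act_vtx.
rewrite -[LHS](card_imset _ h_inj); apply: eq_card => psi.
apply/imsetP/idP => [[phi hphi ->]|hpsi].
  by rewrite unfold_in -hP.
have e : psi = h [ffun x => psi (unact_vtx x)].
  by apply/ffunP=> x; rewrite !ffunE act_vtxK.
by exists [ffun x => psi (unact_vtx x)] => //; rewrite unfold_in hP -e.
Qed.

End Blocks.

(** For each numbering there is exactly one way of permuting the vertices inside
    the blocks after which it is increasing on the blocks. *)
Lemma sum_sortings (X : choiceType) r (u : RT r) (bs : 'I_r -> lab X) M (w : word X M) :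
  (\sum_(sg : fprod (fun j => 'S_(tag (bs j))))
    #|[pred phi : {ffun vtx (act_all (bs := bs) sg) -> 'I_M} |
       composite u phi w && increasing phi]|
   = #|[pred psi : {ffun vtx bs -> 'I_M} | composite u psi w]|)%N.
Proof.
under eq_bigr => sg _ do rewrite card_increasing_act_vtx -sum1_card big_mkcond.
rewrite exchange_big /= -sum1_card [RHS]big_mkcond; apply: eq_bigr => psi _.
rewrite inE; case: ifP => hpsi; last first.
  by rewrite big1 // => sg _; rewrite inE hpsi.
have [/injectiveP psi_inj _ _ _] := and4P hpsi.
have q_inj j : injective (fun k => psi (@mkvtx _ _ bs j k)).
  move=> k l /psi_inj e; apply: val_inj.
  by have := congr1 (fun x : vtx bs => nat_of_ord (tagged x)) e.
pose s j := sval (cid (sort_perm (@q_inj j))).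
have sE j := svalP (cid (sort_perm (@q_inj j))).
pose s0 : fprod (fun j => 'S_(tag (bs j))) := [fprod j => s j].
rewrite (bigD1 s0) //= big1 ?addn0 => [|sg sg0]; rewrite inE hpsi /=.
  case: ifP => // /negP[]; apply/forallP=> j.
  by have := sE j (s0 j); rewrite fprodE eqxx.
case: ifP => // /forallP h; case/eqP: sg0; apply/fprodP => j.
by rewrite fprodE; apply/eqP; rewrite -[_ == _](sE j (sg j)); apply: h.
Qed.

Section ShuffleSum.
Variables (K : comPzRingType) (X : choiceType).

Lemma shuffleE (b : lab (lab X)) (g : 'S_(width b)) :
  shuffle g = increasing [ffun x => g (block_rank b x)].
Proof.
have rank_lt : forall (j : 'I_(tag b)) (k l : 'I_(tag (letter b j))),
    (@tagnat.Rank _ (fun j => tag (letter b j)) j k <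
     @tagnat.Rank _ (fun j => tag (letter b j)) j l)%N = (k < l)%N.
  move=> j k l.
  by have := @tagnat.lt_Rank _ (fun j => tag (letter b j)) j k l; rewrite !ltEord.
apply/idP/idP => [/forallP h|h].
  apply/forallP=> j; apply/forallP=> k; apply/forallP=> l; apply/implyP=> kl.
  have /forallP/(_ (tagnat.Rank j l))/implyP := h (tagnat.Rank j k).
  by rewrite !tagnat.Rank1K eqxx rank_lt kl !ffunE; apply.
apply/forallP=> y; apply/forallP=> z; apply/implyP.
rewrite -(tagnat.sigK y) -(tagnat.sigK z).
case: (tagnat.sig y) => j k; case: (tagnat.sig z) => j' l.
rewrite /tagnat.sig1 !tagnat.rankK /=; case: eqP => //= e; subst j'.
have := rank_lt j k l; rewrite /tagnat.Rank => -> kl.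
move/forallP: h => /(_ j)/forallP/(_ k)/forallP/(_ l)/implyP/(_ kl).
by rewrite !ffunE.
Qed.

(** Placing fixes the numbering. *)
Lemma num_composites_place1 r (u : RT r) (bs : 'I_r -> lab X)
    (p : forall j, 'I_(tag (bs j)) -> nat) a :
  num_composites u (fun j => place1 (p j)) (stamp a) =
  #|[pred phi : {ffun vtx bs -> 'I_(tag a)} | composite u phi (tagged a) &&
      [forall x, val (phi x) == p (tag x) (tagged x)]]|.
Proof.
apply: eq_card => phi; rewrite !inE.
have vE x : vertex_ok u (bs := fun j => place1 (p j)) phi (tagged (stamp a)) x =
    vertex_ok (bs := bs) u phi (tagged a) x && (val (phi x) == p (tag x) (tagged x)).
  rewrite /vertex_ok -andbA [X in _ = _ && X]andbC andbA; congr (_ && _).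
  by rewrite /letter /= !ffunE -pair_eqE /pair_eq /= andbC.
rewrite /composite -!andbA; congr [&& _, _, _ & _].
apply/forallP/andP => [h|[/forallP h1 /forallP h2] x]; last by rewrite vE h1 h2.
by split; apply/forallP=> x; have := h x; rewrite vE => /andP[].
Qed.

Lemma mcoeff_shuffle_sum (b : lab (lab X)) a :
  (\sum_(g : 'S_(width b) | shuffle g) comp_placed K (place g))@_a =
  #|[pred phi : {ffun vtx (letter b) -> 'I_(tag a)} |
      composite (ltree b) phi (tagged a) && increasing phi]|%:R.
Proof.
rewrite mcoeff_sum; under eq_bigr => g _ do
  rewrite mcoeff_comp_placed letter_place (@num_composites_place1 _ _ (letter b)).
rewrite -natr_sum; congr _%:R.
have [e|ne] := eqVneq (tag a) (width b); last first.
  rewrite big1 => [|g _]; rewrite eq_card0 // => phi; rewrite inE;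
    apply/negP=> /andP[/composite_width/eqP]; by rewrite (negPf ne).
case: a e => m w /= e; subst m; rewrite card_composite -sum1_card [RHS]big_mkcond.
rewrite [LHS]big_mkcond; apply: eq_bigr => g _; rewrite inE -shuffleE andbC.
(* For a shuffle g the only candidate numbering is f. *)
case: ifP => //= _; set f := [ffun x => g (block_rank b x)].
have fE (phi : {ffun vtx (letter b) -> 'I_(width b)}) :
    [forall x, val (phi x) == val (g (tagnat.Rank (tag x) (tagged x)))] = (phi == f).
  apply/forallP/eqP => [h|-> x]; last by rewrite !ffunE tagnat.rankE.
  by apply/ffunP=> x; apply: val_inj; rewrite !ffunE tagnat.rankE; apply/eqP.
case: ifP => hf.
  rewrite -(card1 f); apply: eq_card => phi; rewrite !inE fE.
  by case: eqP => [->|]; rewrite ?andbF // hf.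
rewrite eq_card0 // => phi; rewrite !inE fE.
by case: eqP => [->|]; rewrite ?andbF // hf.
Qed.

End ShuffleSum.

Section ExpandComp.
Variables (K : comPzRingType) (X : choiceType) (b : lab (SRT X)).
Let bs : 'I_(tag b) -> lab X := fun j => rep (letter b j).

(** Multiplied by the orders of the stabilizers, the orbit sums become sums over
    the whole symmetric groups. *)
Lemma tensor_orbits :
  tensor (fun j => gamma_val (orb K (letter b j))) *+ \prod_j nstab (letter b j) =
  \sum_(sg : fprod (fun j => 'S_(tag (bs j)))) << [ffun j => act_all (bs := bs) sg j] >>.
Proof.
apply/malgP=> a; rewrite mcoeffMn mcoeff_tensor mcoeff_sum.
transitivity (\prod_(j < tag b) \sum_(s : 'S_(tag (bs j))) (act s == a j)%:R : K).
  rewrite -mulr_natr natr_prod -big_split; apply: eq_bigr => j _.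
  by rewrite mcoeff_orb sum_act same_orbit_rep natrM.
rewrite prod_sum_fprod; apply: eq_bigr => sg _; rewrite mcoeffU.
case: eqP => [<-|ne]; first by rewrite big1 // => j _; rewrite ffunE eqxx.
have [/forallP h|/forallPn[j hj]] := boolP [forall j, act (sg j) == a j].
  by case: ne; apply/ffunP=> j; rewrite ffunE; apply/eqP/h.
by rewrite (bigD1 j) //= (negPf hj) mul0r.
Qed.

(** Permutations inside the blocks together with shuffles give all numberings,
    so that all composites are counted. *)
Lemma mcoeff_expand_comp a :
  (linext (@comp_placed K X) (expand_induce K b))@_a *+ \prod_j nstab (letter b j) =
  (num_composites (ltree b) bs a)%:R.
Proof.
rewrite -mcoeffMn /expand_induce /expand_orbits !linext_comp -linextMn tensor_orbits.
rewrite linext_sum mcoeff_sum /num_composites -sum_sortings natr_sum; apply: eq_bigr => sg _.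
rewrite !linextU /induce linext_sum.
under eq_bigr do rewrite linextU.
rewrite mcoeff_shuffle_sum.
have -> : letter (mklab (ltree b) [ffun j => act_all (bs := bs) sg j]) =
  act_all (bs := bs) sg :> (_ -> _) by apply/funext=> j; rewrite ffunE.
by [].
Qed.

End ExpandComp.

(** * The multiplication on invariants *)

Section MuTilde.
Variables (K : comPzRingType) (X : choiceType) (ut : SRT (SRT X)).
Implicit Type p : lab (lab (nat * X)%type).

(** The element to which the inverse of the trace is applied. *)
Definition expanded : {malg K[lab (lab (nat * X)%type)]} :=
  linext (@induce K X) (linext (@expand_orbits K X) (gamma_val (orb K ut))).

(** This element is the indicator function of a set stable under the action. *)
Lemma mcoeff_expanded p :
  expanded@_p = (`[< placed p >] && (cls (mapcls (forget p)) == ut))%:R.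
Proof.
rewrite /expanded linext_comp (@mcoeff_linext1 _ _ _ _ _ _ (mapcls (forget p))).
  by rewrite mcoeff_orb mcoeff_expand_induce eqxx andbT -natrM mulnb andbC.
by move=> b _ ne; rewrite mcoeff_expand_induce eq_sym (negPf ne) andbF.
Qed.

Lemma placed_actE p s : `[< placed (act (a := p) s) >] = `[< placed p >].
Proof.
apply/asboolP/asboolP; last exact: placed_act.
by apply: placed_orbit; rewrite same_orbit_sym; apply/existsP; exists s.
Qed.

Lemma expanded_act p s : expanded@_(act (a := p) s) = expanded@_p.
Proof. by rewrite !mcoeff_expanded placed_actE forget_act mapcls_act cls_act. Qed.

Lemma expanded_placed p : p \in msupp expanded -> placed p.
Proof.
by rewrite -mcoeff_neq0 mcoeff_expanded; case: asboolP => //; rewrite eqxx.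
Qed.

(** Each element of the orbit of the outer tree arises from as many permutations
    as its stabilizer has elements. *)
Lemma trace_expand_induce : trace (expand_induce K (rep ut)) = expanded *+ nstab ut.
Proof.
apply/malgP=> p; rewrite mcoeff_trace mcoeffMn mcoeff_expanded.
under eq_bigr => s _ do rewrite mcoeff_expand_induce placed_actE forget_act mapcls_act.
case: (`[< _ >]); last by rewrite mul0rn big1.
rewrite andTb; set m := mapcls (forget p).
transitivity (\sum_(s : 'S_(tag m)) (act s == rep ut)%:R : K); first by [].
rewrite sum_act same_orbit_sym same_orbit_rep natrM mulr_natr; case: eqP => e.
  congr (_ *+ _); apply: card_stab_orbit.
  by rewrite same_orbit_sym same_orbit_rep e.
by rewrite !mul0rn.
Qed.

Lemma expand_induce_placed b p : p \in msupp (expand_induce K b) -> placed p.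
Proof.
by rewrite -mcoeff_neq0 mcoeff_expand_induce; case: asboolP => //; rewrite eqxx.
Qed.

(** Any placed preimage under the trace computes the multiplication, not only
    the one that is chosen in its definition. *)
Lemma mu_tildeE z : (forall p, p \in msupp z -> placed p) -> trace z = expanded ->
  mu_tilde (orb K ut) = linext (@comp_placed K X) z.
Proof.
move=> zp zE; rewrite /mu_tilde -/expanded /trace_inv.
case: classical_sets.xgetP => [_ -> [hp hE]|/(_ z)[]]; last by split.
by apply: comp_placed_trace; rewrite ?hE.
Qed.

End MuTilde.

Section IntMuTilde.
Variables (X : choiceType) (ut : SRT (SRT X)).
Let b := rep ut.

Lemma mu_tilde_intr (K : comPzRingType) a :
  (mu_tilde (orb K ut))@_a = ((mu_tilde (orb int ut))@_a)%:~R.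
Proof.
have [z zp zE] := trace_preimage (@expanded_placed int X ut) (@expanded_act int X ut).
pose zK : {malg K[lab (lab (nat * X)%type)]} := \sum_(p <- msupp z) << (z@_p)%:~R *g p >>.
have zKE p : zK@_p = (z@_p)%:~R.
  rewrite mcoeff_sum [in RHS]mcoeff_sum_msupp rmorph_sum; apply: eq_bigr => q _.
  by rewrite mcoeffU mulr_natr rmorphMn.
rewrite (mu_tildeE zp zE) (@mu_tildeE K X ut zK).
- apply: mcoeff_linext_intr => // c d.
  by rewrite !mcoeff_comp_placed rmorph_nat.
- move=> p; rewrite -mcoeff_neq0 zKE => h; apply: zp; rewrite -mcoeff_neq0.
  by apply: contraNneq h => ->.
apply/malgP=> p; rewrite mcoeff_trace mcoeff_expanded.
under eq_bigr => s _ do rewrite zKE.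
by rewrite -rmorph_sum -mcoeff_trace zE mcoeff_expanded rmorph_nat.
Qed.

(** The trace is well defined on the coinvariants, and the trace of the composite
    is constant on orbits of the outer tree.  Hence it may be computed on the
    representative b of ut as well as on the given expansion. *)
Lemma mcoeff_mu_tilde a :
  (mu_tilde (orb int ut))@_a *+ (nstab ut * \prod_j nstab (letter b j)) =
  (num_composites (ltree b) (fun j => rep (letter b j)) a)%:R.
Proof.
have [z zp zE] := trace_preimage (@expanded_placed int X ut) (@expanded_act int X ut).
rewrite mulrnA (mu_tildeE zp zE) -mcoeffMn -linextMn.
rewrite (@comp_placed_trace _ _ _ (expand_induce int b)) ?mcoeff_expand_comp //.
- by move=> p /(fsubsetP (msuppMn_le z _))/zp.
- exact: expand_induce_placed.
by rewrite trace_expand_induce -zE /trace linextMn.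
Qed.

End IntMuTilde.

(** * The multiplication on coinvariants *)

Section Coinvariants.
Variables (K : comPzRingType) (X : choiceType).

(** A map constant on orbits vanishes on the relations that define the
    coinvariants. *)
Lemma linext_coinv (B : choiceType) (F : lab X -> {malg K[B]}) f :
  (forall c s, F (act (a := c) s) = F c) -> coinv_span f -> linext F f = 0.
Proof.
move=> FE; elim=> [|f1 f2 _ IH1 _ IH2|s f1].
- exact: linext0.
- by rewrite linextB IH1 IH2 subrr.
rewrite linextB /permute linext_comp; apply/eqP; rewrite subr_eq0; apply/eqP.
by apply: eq_linext => c _; rewrite linextU FE.
Qed.

Lemma linext_to_S (B : choiceType) (F : lab X -> {malg K[B]}) f g :
  (forall c s, F (act (a := c) s) = F c) -> to_S f = to_S g -> linext F f = linext F g.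
Proof.
move=> FE /eqP; rewrite /to_S -Quotient.idealrBE => /asboolP/(linext_coinv FE).
by rewrite linextB => /eqP; rewrite subr_eq0 => /eqP.
Qed.

End Coinvariants.

Lemma mcoeff_mu (X : choiceType) (ut : SRT (SRT X)) (chi : {malg int[SRT X]}) a :
  mu (Sbasis int ut) = \sum_(s <- msupp chi) Sbasis int s *~ chi@_s ->
  (num_composites (ltree (rep ut)) (fun j => rep (letter (rep ut) j)) a)%:R =
  chi@_(cls a) * (nstab (cls a))%:R.
Proof.
pose F b := comp_lab int (mklab (ltree b) [ffun j => rep (letter b j)]) : {malg int[lab X]}.
have F_act b s : trace (F (act (a := b) s)) = trace (F b).
  apply/malgP=> c; rewrite !mcoeff_trace_comp.
  have lE d : letter (mklab (ltree d) [ffun j => rep (letter d j)]) =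
      (fun j => rep (letter d j)) :> ('I_(tag d) -> lab X).
    by apply/funext=> j; rewrite ffunE.
  rewrite !lE; congr _%:R.
  rewrite -[RHS](num_composites_move _ _ s^-1) invgK; congr num_composites.
  by apply/funext=> j; rewrite /letter /= ffunE.
move=> h; set b := rep ut.
have h1 : to_S (linext F (generic_quotient.repr (Sbasis int ut))) =
    to_S (\sum_(s <- msupp chi) << rep s >> *~ chi@_s).
  rewrite [LHS]h /to_S raddf_sum; apply: eq_bigr => s _.
  by rewrite raddfMz.
have trE (f g : {malg int[lab X]}) : to_S f = to_S g -> trace f = trace g.
  apply: linext_to_S => c s; rewrite [RHS](reindex_inj (mulgI s)) /=.
  by apply: eq_bigr => s' _; rewrite actM.
have e1 := trE _ _ h1.
have e2 : trace (linext F (generic_quotient.repr (Sbasis int ut))) = trace (F b).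
  rewrite -(linextU F b) /trace !linext_comp; apply: linext_to_S.
    by move=> c s; apply: F_act.
  exact: (generic_quotient.reprK (Sbasis int ut)).
have /(congr1 (mcoeff a)) := e2; rewrite e1 mcoeff_trace_comp.
have -> : letter (mklab (ltree b) [ffun j => rep (letter b j)]) =
      (fun j => rep (letter b j)) :> ('I_(tag b) -> lab X).
  by apply/funext=> j; rewrite ffunE.
move=> <-; rewrite /trace linext_sum mcoeff_sum.
have trZ (f : {malg int[lab X]}) (k : int) :
    linext (fun c => \sum_(s : 'S_(tag c)) << act s >>) (f *~ k) =
    linext (fun c => \sum_(s : 'S_(tag c)) << act s >>) f *~ k :> {malg int[lab X]}.
  by case: k => k; rewrite ?NegzE ?mulrNz -!pmulrn ?linextN linextMn.
rewrite [RHS](_ : _ = \sum_(s <- msupp chi) chi@_s * ((s == cls a) * nstab (cls a))%:R).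
  apply: eq_bigr => s _; rewrite trZ raddfMz linextU /= mcoeff_sum.
  under [X in X *~ _]eq_bigr do rewrite mcoeffU.
  rewrite sum_act same_orbit_rep -mulrzr mulrC intz eq_sym; congr (_ * _).
  by case: eqP => [->|]; rewrite ?mul0n.
rewrite [in LHS]mcoeff_sum_msupp mulr_suml; apply: eq_bigr => s _.
by rewrite -mulrA natrM.
Qed.

Lemma prod_nstab_orbit (X : choiceType) (b b' : lab (SRT X)) : same_orbit b b' ->
  (\prod_j nstab (letter b j) = \prod_j nstab (letter b' j))%N.
Proof.
case/existsP=> s /eqP <-; rewrite (reindex_inj (@perm_inj _ (s^-1)%g)) /=.
by apply: eq_bigr => j _; rewrite /letter /= ffunE.
Qed.

(** * Comparison *)

Theorem theorem5p1 (K : comPzRingType) (X : choiceType) (n : nat) (u : RT n)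
    (t : 'I_n -> SRT X) (chi : {malg int[SRT X]}) :
  let ut : SRT (SRT X) := cls (mklab u [ffun j => t j]) in
  let den : nat := (nstab ut * \prod_(j < n) nstab (t j))%N in
  mu (Sbasis int ut) = \sum_(s <- msupp chi) Sbasis int s *~ chi@_s ->
  (forall s : SRT X, (den%:Z %| chi@_s * (nstab s)%:Z)%Z) /\
  mu_tilde (orb K ut) =
    \sum_(s <- msupp chi)
      mscale ((chi@_s * (nstab s)%:Z) %/ den%:Z)%Z%:~R (gamma_val (orb K s)).
Proof.
move=> ut den hmu.
have denE : den = (nstab ut * \prod_j nstab (letter (rep ut) j))%N.
  have h : same_orbit (rep ut) (mklab u [ffun j => t j]) by rewrite same_orbit_rep.
  rewrite (prod_nstab_orbit h); congr (_ * _)%N.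
  by apply: eq_bigr => j _; rewrite /letter /= ffunE.
have stab_gt0 (Y : choiceType) (s : SRT Y) : (0 < nstab s)%N.
  by apply/card_gt0P; exists 1%g; rewrite inE act1.
have den_neq0 : den%:Z != 0.
  by rewrite -lt0n muln_gt0 stab_gt0 prodn_gt0.
have key a : (mu_tilde (orb int ut))@_a * den%:Z = chi@_(cls a) * (nstab (cls a))%:Z.
  have := mcoeff_mu a hmu; rewrite -(mcoeff_mu_tilde ut a) -denE -[LHS]mulr_natr.
  by rewrite !natz.
split=> [s|].
  by apply/intdiv.dvdzP; exists (mu_tilde (orb int ut))@_(rep s); rewrite key repK.
apply/malgP=> a; rewrite mu_tilde_intr mcoeff_sum.
have q s : cls a = s -> (mu_tilde (orb int ut))@_a = (chi@_s * (nstab s)%:Z %/ den%:Z)%Z.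
  by move=> <-; rewrite -key intdiv.mulzK.
under eq_bigr => s _ do rewrite mcoeff_mscale mcoeff_orb.
have [ac|ac] := boolP (cls a \in msupp chi).
  rewrite (bigD1_seq (cls a)) ?fset_uniq //= eqxx mulr1 -q //.
  rewrite big1 ?addr0 // => s /negPf sa.
  by rewrite eq_sym sa mulr0.
rewrite big1_seq => [|s /andP[_ sc]].
  by rewrite (q _ erefl) (mcoeff_outdom ac) mul0r intdiv.div0z.
by case: eqP => [e|]; rewrite ?mulr0 //; rewrite e sc in ac.
Qed.
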